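(* Let $u=(U(x,t),0,0)$, with a given function $P=P(x,t)$, be a solution for all $t\in\mathbb{R}$ of the Navier-Stokes equations $$\frac{\partial}{\partial t}u+(u\cdot\nabla)u=\nu\Delta u-\nabla P,\qquad \nabla\cdot u=0$$ in the channel $\mathcal{O}=\mathbb{R}\times\mathbb{R}\times[0,h]$ with the no-slip condition $u=0$ on $\{x_3=0\}\cup\{x_3=h\}$, and suppose that: (i) $u\in C^\infty(\mathcal{O}\times\mathbb{R})$; (ii) $u$ is periodic in $x_1$ and $x_2$ with periods $\Pi_1$ and $\Pi_2$ respectively; (iii) $\sup_{t\in\mathbb{R}}\int_0^{\Pi_1}\int_0^{\Pi_2}\int_0^h u(x,t)\cdot u(x,t)\,dx<\infty$. Then $U$ depends only on $x_3$ and $t$, i.e. $U=U(x_3,t)$, and $$U(x_3,t)=\int_{-\infty}^{t}\sum_{k=1}^{\infty}\frac{2\left((-1)^k-1\right)}{k\pi}e^{-\nu(\frac{\pi k}{h})^2(t-\tau)}\sin\left(\frac{\pi k x_3}{h}\right)\tilde p_1(\tau)\,d\tau,$$ where $\tilde p_1(t)=\partial P/\partial x_1$.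
   Context: Here $x=(x_1,x_2,x_3)$; $\nu>0$ (kinematic viscosity), $h>0$, $\Pi_1,\Pi_2>0$ are constants. $P=p+\Phi$ is the sum of the pressure $p(x,t)$ and a time-independent potential $\Phi(x)$. For solutions of the form $u=(U,0,0)$ the equations force $P$ to be of the form $P=\tilde p_0(t)+x_1\tilde p_1(t)$, which defines $\tilde p_1(t)$. *)

(* Defs.v *)
From Stdlib Require Import Reals.
From Coquelicot Require Import Coquelicot.
Open Scope R_scope.

Inductive axis := e1 | e2 | e3.

Inductive coord := space (i : axis) | time.
Coercion space : axis >-> coord.

(* (x1, x2, x3, t) *)
Definition point := (R * R * R * R)%type.

Definition get (c : coord) (p : point) : R :=
  let '(x1, x2, x3, t) := p in
  match c with
  | space e1 => x1 | space e2 => x2 | space e3 => x3 | time => t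
  end.

Definition upd (c : coord) (p : point) (y : R) : point :=
  let '(x1, x2, x3, t) := p in
  match c with
  | space e1 => (y, x2, x3, t) | space e2 => (x1, y, x3, t)
  | space e3 => (x1, x2, y, t) | time => (x1, x2, x3, y)
  end.

Definition sum_axis (F : axis -> R) : R := F e1 + F e2 + F e3.

(* Partial derivatives relative to a domain D: only the values of f on D
   count, so at a boundary point of a slab the normal derivative is the
   one-sided one. *)
Definition is_pd (D : point -> Prop) (c : coord) (f : point -> R) (p : point)
    (l : R) : Prop :=
  filterlim (fun y => (f (upd c p y) - f p) / (y - get c p))
    (within (fun y => D (upd c p y)) (locally' (get c p))) (locally l).

Definition ex_pd D c f p : Prop := exists l, is_pd D c f p l.

(* Meaningful only when [ex_pd D c f p]. *)
Definition pd D c f p : R := iota (is_pd D c f p).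

Definition continuous_on (D : point -> Prop) (f : point -> R) : Prop :=
  forall p, D p -> filterlim f (within D (locally p)) (locally (f p)).

Fixpoint of_class_C (D : point -> Prop) (n : nat) (f : point -> R) : Prop :=
  continuous_on D f /\
  match n with
  | O => True
  | S m => forall c, (forall p, D p -> ex_pd D c f p) /\
                     of_class_C D m (pd D c f)
  end.

(* On a closed slab this is C^infinity up to the boundary. *)
Definition smooth_on D f : Prop := forall n, of_class_C D n f.

(* (R x R x [0,h]) x R *)
Definition channel (h : R) (p : point) : Prop := 0 <= get e3 p <= h.

(* The derivatives of the velocity are total functions here; their existence
   is to be ensured separately by smoothness of u. *)
Definition navier_stokes (D : point -> Prop) (nu : R)
    (u : axis -> point -> R) (P : point -> R) : Prop :=
  forall p, D p ->
    (forall i : axis,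
       ex_pd D i P p /\
       pd D time (u i) p + sum_axis (fun j => u j p * pd D j (u i) p)
       = nu * sum_axis (fun j => pd D j (pd D j (u i)) p) - pd D i P p) /\
    sum_axis (fun j => pd D j (u j) p) = 0.

Definition no_slip (h : R) (u : axis -> point -> R) : Prop :=
  forall p, get e3 p = 0 \/ get e3 p = h -> forall i, u i p = 0.

Definition periodic_in (D : point -> Prop) (c : coord) (L : R)
    (u : axis -> point -> R) : Prop :=
  forall p, D p -> forall i, u i (upd c p (get c p + L)) = u i p.

Definition energy (L1 L2 h : R) (u : axis -> point -> R) (t : R) : R :=
  RInt (fun x1 => RInt (fun x2 => RInt (fun x3 =>
    sum_axis (fun i => u i (x1, x2, x3, t) * u i (x1, x2, x3, t)))
    0 h) 0 L2) 0 L1.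

Definition unidirectional (U : point -> R) (i : axis) : point -> R :=
  match i with e1 => U | _ => fun _ => 0 end.

(* The k-th summand, at elapsed time s = t - tau. *)
Definition kernel_term (nu h z s : R) (k : nat) : R :=
  2 * ((-1) ^ k - 1) / (INR k * PI)
  * exp (- nu * (PI * INR k / h) ^ 2 * s) * sin (PI * INR k * z / h).

(* The sum over k >= 1. *)
Definition kernel (nu h z s : R) : R :=
  Series (fun n => kernel_term nu h z s (S n)).

(* Main.v *)
(** Incompressibility makes U independent of x1, and the transverse momentum
    equations make P a function of x1 and t only; hence
    [U_t = nu (U_22 + U_33) - p1(t)] with Dirichlet data in x3 and periodicity
    in x2.  The k-th sine coefficient in x3, as a function of x2 and t, has a
    variance over one x2-period that no longer sees p1 and satisfies
    [F' <= - 2 nu lambda_k F]; being bounded for all negative times it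
    vanishes, so no coefficient, hence not U, depends on x2.

    Each coefficient then solves [c_k' = - nu lambda_k c_k - m_k p1], and
    summing Duhamel's formula over k gives
    [U(z,t) = (heat semigroup from time a) + int_a^t kernel * p1].  The first
    term is O(1/(t - a)) by the energy bound.  At elapsed time 0 the kernel
    series converges only conditionally, but for fixed z Abel summation shows
    that it converges uniformly in the elapsed time s >= 0, so it may be
    integrated term by term up to tau = t. *)

Require Import Defs.
From Stdlib Require Import Reals ZArith Lra Lia ClassicalEpsilon.
From Coquelicot Require Import Coquelicot.
Open Scope R_scope.

(** * Calculus on the line *)

(** Returning from coefficients to functions requires the sine series of a profile to converge to it
    at each single point. Chernoff's division argument gives this from continuity, a derivative at
    that point and Bessel's inequality. The same convergence theorem then serves twice: as
    completeness of the sine system, when equal coefficients must force equal profiles, and as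
    resummation, when Duhamel's formulas for the modes are put together again.

    The fields are controlled only on the closed channel, with one-sided derivatives at the walls.
    Profiles are therefore extended to all z by clamping z to [0, h]. Joint continuity survives this
    globally, but differentiability in z holds only for 0 < z < h, since clamping may create corners
    at the walls. Hence the shape of the calculus lemmas: continuity everywhere, derivatives only
    inside.

    The energy bound is first used integrated over x2, to control the variance; a bound on each
    section separately becomes available only once independence of x2 is known. *)

Lemma sum_n_S (a : nat -> R) n : sum_n a (S n) = sum_n a n + a (S n).
Proof. exact (sum_Sn a n). Qed.

Lemma continuous_pair {T U V : UniformSpace} (f : T -> U) (g : T -> V) (x : T) :
  continuous f x -> continuous g x -> continuous (fun y => (f y, g y)) x.
Proof.
  intros Hf Hg.
  apply (continuous_comp_2 f g (fun a b => (a, b)) x Hf Hg).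
  apply (continuous_ext (fun p => p)); [now intros [] | apply continuous_id].
Qed.

Lemma cont_plus {T : UniformSpace} (f g : T -> R) x :
  continuous f x -> continuous g x -> continuous (fun y => f y + g y) x.
Proof. exact (continuous_plus f g x). Qed.

Lemma cont_opp {T : UniformSpace} (f : T -> R) x :
  continuous f x -> continuous (fun y => - f y) x.
Proof. exact (continuous_opp f x). Qed.

Lemma cont_minus {T : UniformSpace} (f g : T -> R) x :
  continuous f x -> continuous g x -> continuous (fun y => f y - g y) x.
Proof. exact (continuous_minus f g x). Qed.

Lemma cont_mult {T : UniformSpace} (f g : T -> R) x :
  continuous f x -> continuous g x -> continuous (fun y => f y * g y) x.
Proof. exact (continuous_mult f g x). Qed.

Lemma cont_real {T : UniformSpace} (phi : R -> R) (f : T -> R) x :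
  (forall y, continuous phi y) -> continuous f x ->
  continuous (fun y => phi (f y)) x.
Proof. intros Hp Hf. now apply continuous_comp. Qed.

Lemma cont_of_derivable (f : R -> R) x : ex_derive f x -> continuous f x.
Proof. exact (ex_derive_continuous f x). Qed.

Lemma cont_sin y : continuous sin y.
Proof. apply cont_of_derivable. auto_derive. trivial. Qed.

Lemma cont_cos y : continuous cos y.
Proof. apply cont_of_derivable. auto_derive. trivial. Qed.

Lemma cont_exp y : continuous exp y.
Proof. apply cont_of_derivable. auto_derive. trivial. Qed.

Definition cont2 (f : R -> R -> R) : Prop :=
  forall q : R * R, continuous (fun q : R * R => f (fst q) (snd q)) q.

Definition cont3 (f : R -> R -> R -> R) : Prop :=
  forall q : R * R * R,
    continuous (fun q : R * R * R => f (fst (fst q)) (snd (fst q)) (snd q)) q.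

Lemma cont2_comp {T : UniformSpace} f (a b : T -> R) x :
  cont2 f -> continuous a x -> continuous b x ->
  continuous (fun y => f (a y) (b y)) x.
Proof.
  intros Hf Ha Hb.
  apply (continuous_comp (fun y => (a y, b y)) (fun q => f (fst q) (snd q)));
    [now apply continuous_pair|apply Hf].
Qed.

Lemma cont3_comp {T : UniformSpace} f (a b c : T -> R) x :
  cont3 f -> continuous a x -> continuous b x -> continuous c x ->
  continuous (fun y => f (a y) (b y) (c y)) x.
Proof.
  intros Hf Ha Hb Hc.
  apply (continuous_comp (fun y => (a y, b y, c y))
           (fun q => f (fst (fst q)) (snd (fst q)) (snd q)));
    [now repeat apply continuous_pair|apply Hf].
Qed.

Definition sine_mode (h : R) (k : nat) (z : R) : R := sin (PI * INR k * z / h).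
Definition cosine_mode (h : R) (k : nat) (z : R) : R := cos (PI * INR k * z / h).
Definition wavenumber (h : R) (k : nat) : R := PI * INR k / h.

Definition sine_coef (h : R) (f : R -> R) (k : nat) : R :=
  RInt (fun z => f z * sine_mode h k z) 0 h.

Lemma is_derive_sine_mode h k z :
  is_derive (sine_mode h k) z (wavenumber h k * cosine_mode h k z).
Proof.
  unfold sine_mode, cosine_mode, wavenumber. auto_derive; [easy|]. unfold Rdiv. ring.
Qed.

Lemma is_derive_cosine_mode h k z :
  is_derive (cosine_mode h k) z (- (wavenumber h k * sine_mode h k z)).
Proof.
  unfold sine_mode, cosine_mode, wavenumber. auto_derive; [easy|]. unfold Rdiv. ring.
Qed.

Lemma Derive_sine_mode h k z :
  Derive (fun y => sine_mode h k y) z = wavenumber h k * cosine_mode h k z.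
Proof. apply is_derive_unique, is_derive_sine_mode. Qed.

Lemma Derive_cosine_mode h k z :
  Derive (fun y => cosine_mode h k y) z = - (wavenumber h k * sine_mode h k z).
Proof. apply is_derive_unique, is_derive_cosine_mode. Qed.

Ltac ex_derive_mode :=
  match goal with
  | |- ex_derive (fun y => sine_mode _ _ y) _ =>
      eexists; apply is_derive_sine_mode
  | |- ex_derive (fun y => cosine_mode _ _ y) _ =>
      eexists; apply is_derive_cosine_mode
  | |- _ => exact I
  end.

Lemma cont_sine_mode h k z : continuous (sine_mode h k) z.
Proof. apply cont_of_derivable. eexists. apply is_derive_sine_mode. Qed.

Lemma cont_cosine_mode h k z : continuous (cosine_mode h k) z.
Proof. apply cont_of_derivable. eexists. apply is_derive_cosine_mode. Qed.

(* [RInt] makes equations live in the carrier of a module, where [field] is lost. *)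
Ltac at_R := match goal with |- @eq _ ?a ?b => change (@eq R a b) end.

(** The clauses for partial applications such as [Rmult c] or [f a] catch functions that unification
    leaves eta-reduced. *)
Ltac cont := repeat
  match goal with
  | |- continuous (fun y => ?c) _ => apply continuous_const
  | |- continuous (fun y => y) _ => apply continuous_id
  | H : forall y, continuous ?f y |- continuous ?f _ => apply H
  | |- continuous (Rmult ?c) ?x => apply (cont_mult (fun _ => c) (fun y => y) x)
  | |- continuous (Rplus ?c) ?x => apply (cont_plus (fun _ => c) (fun y => y) x)
  | |- continuous (Rminus ?c) ?x => apply (cont_minus (fun _ => c) (fun y => y) x)
  | |- continuous fst _ => apply continuous_fst
  | |- continuous snd _ => apply continuous_snd
  | |- continuous (fun y => _ + _) _ => apply cont_plus
  | |- continuous (fun y => _ - _) _ => apply cont_minus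
  | |- continuous (fun y => _ * _) _ => apply cont_mult
  | |- continuous (fun y => - _) _ => apply cont_opp
  | |- continuous (fun y => sin _) _ => apply (cont_real sin); [exact cont_sin|]
  | |- continuous (fun y => cos _) _ => apply (cont_real cos); [exact cont_cos|]
  | |- continuous (fun y => exp _) _ => apply (cont_real exp); [exact cont_exp|]
  | |- continuous (fun y => fst _) _ =>
      first [apply continuous_fst |
             apply (continuous_comp _ fst); [|apply continuous_fst]]
  | |- continuous (fun y => snd _) _ =>
      first [apply continuous_snd |
             apply (continuous_comp _ snd); [|apply continuous_snd]]
  | H : forall y, continuous ?f y |- continuous (fun y => ?f _) _ =>
      apply (cont_real f); [exact H|]
  | |- continuous (sine_mode ?h ?k) _ => exact (cont_sine_mode h k _)
  | |- continuous (cosine_mode ?h ?k) _ => exact (cont_cosine_mode h k _)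
  | |- continuous (fun y => sine_mode ?h ?k _) _ =>
      apply (cont_real (sine_mode h k)); [exact (cont_sine_mode h k)|]
  | |- continuous (fun y => cosine_mode ?h ?k _) _ =>
      apply (cont_real (cosine_mode h k)); [exact (cont_cosine_mode h k)|]
  | H : cont2 ?f |- continuous (fun y => ?f _ _) _ => apply (cont2_comp f); [exact H| |]
  | H : cont2 ?f |- continuous (?f ?a) _ =>
      apply (cont2_comp f (fun _ => a) (fun y => y)); [exact H| |]
  | H : cont3 ?f |- continuous (fun y => ?f _ _ _) _ => apply (cont3_comp f); [exact H| | |]
  | H : cont3 ?f |- continuous (?f ?a ?b) _ =>
      apply (cont3_comp f (fun _ => a) (fun _ => b) (fun y => y)); [exact H| | |]
  end.

Lemma cont_ex_RInt (f : R -> R) a b :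
  (forall z, continuous f z) -> ex_RInt f a b.
Proof. intros H. apply (ex_RInt_continuous f). intros; apply H. Qed.

Ltac known H := repeat match goal with
  | |- _ /\ _ => split
  | |- True => exact I
  | |- ex_derive _ _ => eexists; apply H
  end.

Ltac integrable := apply cont_ex_RInt; intros; cont.

Lemma RInt_lin (f g : R -> R) a b al be :
  ex_RInt f a b -> ex_RInt g a b ->
  RInt (fun z => al * f z + be * g z) a b = al * RInt f a b + be * RInt g a b.
Proof.
  intros Hf Hg. apply is_RInt_unique.
  apply (is_RInt_plus (fun z => al * f z) (fun z => be * g z)).
  - apply (is_RInt_scal f a b al). now apply (RInt_correct f).
  - apply (is_RInt_scal g a b be). now apply (RInt_correct g).
Qed.

Lemma RInt_mult_l (f : R -> R) a b al :
  ex_RInt f a b -> RInt (fun z => al * f z) a b = al * RInt f a b.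
Proof. intros Hf. exact (RInt_scal f a b al Hf). Qed.

Lemma RInt_cst a b c : RInt (fun _ => c) a b = (b - a) * c.
Proof. exact (RInt_const a b c). Qed.

Lemma is_derive_zero_const (f : R -> R) a b :
  a <= b -> (forall x, a <= x <= b -> continuous f x) ->
  (forall x, a < x < b -> is_derive f x 0) -> f b = f a.
Proof.
  intros Hab Hc Hd.
  destruct (MVT_gen f a b (fun _ => 0)) as [c [_ Hc']].
  - rewrite Rmin_left, Rmax_right by lra. exact Hd.
  - rewrite Rmin_left, Rmax_right by lra. intros x Hx.
    apply continuity_pt_filterlim. now apply Hc.
  - lra.
Qed.

(** The difference between [f] and the primitive of [df] is continuous with zero derivative inside,
    hence constant. Nothing is asked of the derivative at the end points, where clamped profiles may
    have corners. *)
Lemma RInt_of_derive (f df : R -> R) a b :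
  a <= b -> (forall x, continuous f x) ->
  (forall x, a < x < b -> is_derive f x (df x)) ->
  (forall x, continuous df x) -> RInt df a b = f b - f a.
Proof.
  intros Hab Hf Hd Hdf.
  assert (HI : forall x, is_derive (fun y => RInt df a y) x (df x)).
  { intros x. apply (is_derive_RInt df (fun y => RInt df a y) a x); [|apply Hdf].
    apply filter_forall. intros y. apply (RInt_correct df). now apply cont_ex_RInt. }
  assert (E := is_derive_zero_const (fun x => f x - RInt df a x) a b Hab).
  cbv beta in E. rewrite RInt_point in E. change (zero : R) with 0 in E.
  enough (f b - RInt df a b = f a - 0) by lra.
  apply E.
  - intros x _. apply cont_minus; [apply Hf|].
    apply cont_of_derivable. exists (df x). apply HI.
  - intros x Hx. replace 0 with (df x - df x) by ring.
    apply (is_derive_minus f (fun y => RInt df a y) x); [now apply Hd|apply HI].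
Qed.

(** The primitive is squeezed between 0 and the total integral, so it is constant and its derivative
    [f] vanishes inside; continuity adds the end points. *)
Lemma RInt_nonneg_zero (f : R -> R) a b :
  a < b -> (forall x, continuous f x) -> (forall x, 0 <= f x) ->
  RInt f a b <= 0 -> forall x, a <= x <= b -> f x = 0.
Proof.
  intros Hab Hf Hp HI x Hx.
  set (G := fun y => RInt f a y).
  assert (HG : forall y, is_derive G y (f y)).
  { intros y. apply (is_derive_RInt f G a y); [|apply Hf].
    apply filter_forall. intros y'. apply (RInt_correct f). now apply cont_ex_RInt. }
  assert (HG0 : forall y, a <= y <= b -> G y = 0).
  { intros y Hy. apply Rle_antisym.
    - assert (Hs : RInt f a y + RInt f y b = RInt f a b)
        by (apply (RInt_Chasles f); now apply cont_ex_RInt).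
      assert (0 <= RInt f y b)
        by (apply RInt_ge_0; [lra|now apply cont_ex_RInt|intros; apply Hp]).
      unfold G. lra.
    - apply RInt_ge_0; [lra|now apply cont_ex_RInt|intros; apply Hp]. }
  assert (Hin : forall y, a < y < b -> f y = 0).
  { intros y Hy. rewrite <- (is_derive_unique G y (f y) (HG y)).
    rewrite (Derive_ext_loc G (fun _ => 0)); [apply Derive_const|].
    assert (Hd : 0 < Rmin (y - a) (b - y)) by (apply Rmin_pos; lra).
    exists (mkposreal _ Hd). intros y' Hy'. apply HG0.
    change (Rabs (y' - y) < Rmin (y - a) (b - y)) in Hy'.
    assert (H1 := Rmin_l (y - a) (b - y)). assert (H2 := Rmin_r (y - a) (b - y)).
    apply Rabs_def2 in Hy'. lra. }
  destruct (Req_dec (f x) 0) as [|Hne]; [easy|exfalso].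
  assert (Hpos : 0 < f x) by (specialize (Hp x); lra).
  destruct (proj1 (filterlim_locally f (f x)) (Hf x) (mkposreal _ Hpos)) as [d Hd].
  (* A point of the open interval close to x is found by moving from x towards the middle; a step of
     at most (b - a) / 3 cannot cross the far end. *)
  assert (exists y, a < y < b /\ Rabs (y - x) < d) as [y [Hy Hyd]].
  { destruct d as [d Hd0]; simpl in *. clear Hd.
    set (e := Rmin (d / 2) ((b - a) / 3)).
    assert (He1 := Rmin_l (d / 2) ((b - a) / 3)).
    assert (He2 := Rmin_r (d / 2) ((b - a) / 3)).
    assert (He : 0 < e) by (apply Rmin_pos; lra). fold e in He1, He2.
    destruct (Rle_lt_dec x ((a + b) / 2)).
    - exists (x + e). split; [lra|]. replace (x + e - x) with e by ring.
      rewrite Rabs_pos_eq; lra.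
    - exists (x - e). split; [lra|]. replace (x - e - x) with (- e) by ring.
      rewrite Rabs_Ropp, Rabs_pos_eq; lra. }
  specialize (Hd y Hyd). change (Rabs (f y - f x) < f x) in Hd.
  rewrite (Hin y Hy) in Hd. apply Rabs_def2 in Hd. lra.
Qed.

(* Compactness of [a, b] upgrades joint continuity to continuity uniform in z. *)
Lemma continuous_uniform {T : UniformSpace} (f : T -> R -> R) (x : T) a b :
  (forall z, a <= z <= b -> continuous (fun p : T * R => f (fst p) (snd p)) (x, z)) ->
  forall eps : posreal,
    locally x (fun y => forall z, a <= z <= b -> Rabs (f y z - f x z) < eps).
Proof.
  intros Hf eps.
  assert (Hex : forall z, exists d : posreal, a <= z <= b ->
    forall y z', ball x d y -> Rabs (z' - z) < d ->
    Rabs (f y z' - f x z) < eps / 2).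
  { intros z. destruct (classic (a <= z <= b)) as [Hz|Hz].
    - destruct (proj1 (filterlim_locally _ (f x z)) (Hf z Hz) (pos_div_2 eps))
        as [d Hd].
      exists d. intros _ y z' Hy Hz'. apply (Hd (y, z')). now split.
    - exists (mkposreal 1 Rlt_0_1). easy. }
  set (delta z := proj1_sig (constructive_indefinite_description _ (Hex z))).
  assert (Hdelta : forall z, a <= z <= b ->
    forall y z', ball x (delta z) y -> Rabs (z' - z) < delta z ->
    Rabs (f y z' - f x z) < eps / 2).
  { intros z. exact (proj2_sig (constructive_indefinite_description _ (Hex z))). }
  destruct (compactness_value_1d a b delta) as [d Hd].
  exists d. intros y Hy z Hz.
  (* The compactness lemma delivers the centre t of a covering ball only up to double negation. Both
     f y z and f x z are then compared with f x t, hence eps / 2 in the choice of radii. *)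
  apply NNPP. intros Hn. apply (Hd z Hz). intros [t [Ht [Hzt Hdt]]]. apply Hn.
  assert (H1 := Hdelta t Ht y z (ball_le x d (delta t) Hdt y Hy) Hzt).
  assert (H2 := Hdelta t Ht x z (ball_center x (delta t)) Hzt).
  replace (f y z - f x z) with ((f y z - f x t) - (f x z - f x t)) by ring.
  eapply Rle_lt_trans; [apply Rabs_triang|]. rewrite Rabs_Ropp. lra.
Qed.

Lemma cont_partial {T : UniformSpace} (f : T -> R -> R) (x : T) z :
  continuous (fun p : T * R => f (fst p) (snd p)) (x, z) -> continuous (f x) z.
Proof.
  intros H. apply (continuous_comp (fun z => (x, z)) (fun p => f (fst p) (snd p)) z); [|easy].
  apply continuous_pair; cont.
Qed.

Lemma cont_RInt_param {T : UniformSpace} (f : T -> R -> R) a b (x : T) :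
  a <= b ->
  (forall y z, continuous (fun p : T * R => f (fst p) (snd p)) (y, z)) ->
  continuous (fun y => RInt (f y) a b) x.
Proof.
  intros Hab Hf. apply filterlim_locally. intros eps.
  (* The added 1 keeps the denominator positive when a = b. *)
  assert (He : 0 < eps / (b - a + 1)) by (apply Rdiv_lt_0_compat; [apply eps|lra]).
  generalize (continuous_uniform f x a b (fun z _ => Hf x z) (mkposreal _ He)).
  apply filter_imp. intros y Hy. simpl in Hy.
  assert (Hi : forall y, ex_RInt (f y) a b).
  { intros y'. apply cont_ex_RInt. intros z. now apply cont_partial. }
  change (Rabs (RInt (f y) a b - RInt (f x) a b) < eps).
  replace (RInt (f y) a b - RInt (f x) a b)
    with (1 * RInt (f y) a b + (-1) * RInt (f x) a b) by ring.
  rewrite <- RInt_lin by easy.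
  apply Rle_lt_trans with ((b - a) * (eps / (b - a + 1))).
  - apply abs_RInt_le_const; [easy| |].
    + apply cont_ex_RInt. intros z.
      apply cont_plus; apply cont_mult; cont; now apply cont_partial.
    + intros z Hz. replace (1 * f y z + -1 * f x z) with (f y z - f x z) by ring.
      left. now apply Hy.
  - apply Rlt_le_trans with ((b - a + 1) * (eps / (b - a + 1))).
    + apply Rmult_lt_compat_r; lra.
    + right. field. lra.
Qed.

Lemma is_derive_RInt_parameter (f df : R -> R -> R) a b t :
  (forall s z, is_derive (fun s => f s z) s (df s z)) ->
  (forall s z, continuous (f s) z) ->
  (forall s z, continuous (fun p : R * R => df (fst p) (snd p)) (s, z)) ->
  is_derive (fun s => RInt (f s) a b) t (RInt (df t) a b).
Proof.
  intros Hd Hf Hdf.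
  rewrite <- (RInt_ext (fun z => Derive (fun s => f s z) t) (df t))
    by (intros z _; apply (is_derive_unique (fun s => f s z) t); apply Hd).
  apply (is_derive_RInt_param f a b t).
  - apply filter_forall. intros s z _. now exists (df s z).
  - intros z _. apply continuity_2d_pt_ext with df.
    + intros s z'. symmetry. apply (is_derive_unique (fun s => f s z') s). apply Hd.
    + apply continuity_2d_pt_filterlim. apply Hdf.
  - apply filter_forall. intros s. apply cont_ex_RInt. apply Hf.
Qed.

(** The 1-Lipschitz retraction of the line onto [a, b]; composing with it extends a function known
    on [a, b] to a total one without losing continuity. *)
Definition clamp a b x : R := Rmax a (Rmin b x).

Lemma clamp_in a b x : a <= b -> a <= clamp a b x <= b.
Proof.
  intros Hab. unfold clamp. split; [apply Rmax_l|].
  apply Rmax_lub; [easy|apply Rmin_l].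
Qed.

Lemma clamp_id a b x : a <= x <= b -> clamp a b x = x.
Proof. intros Hx. unfold clamp. now rewrite Rmin_right, Rmax_right by lra. Qed.

Lemma clamp_lipschitz a b x y : Rabs (clamp a b y - clamp a b x) <= Rabs (y - x).
Proof.
  unfold clamp, Rmax, Rmin.
  repeat destruct Rle_dec; unfold Rabs; repeat destruct Rcase_abs; lra.
Qed.

Lemma cont_clamp a b x : continuous (clamp a b) x.
Proof.
  apply filterlim_locally. intros eps. exists eps. intros y Hy.
  eapply Rle_lt_trans; [apply clamp_lipschitz|exact Hy].
Qed.

(** * Sine series *)

Lemma sine_mode_0 h k : sine_mode h k 0 = 0.
Proof. unfold sine_mode, Rdiv. rewrite Rmult_0_r, Rmult_0_l. apply sin_0. Qed.

Lemma sine_mode_O h z : sine_mode h 0 z = 0.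
Proof.
  unfold sine_mode, Rdiv. simpl. rewrite Rmult_0_r, !Rmult_0_l. apply sin_0.
Qed.

Lemma sin_cos_nat_PI k : sin (PI * INR k) = 0 /\ cos (PI * INR k) = (-1) ^ k.
Proof.
  induction k as [|k [IHs IHc]].
  - simpl. rewrite Rmult_0_r. split; [apply sin_0|apply cos_0].
  - rewrite S_INR, Rmult_plus_distr_l, Rmult_1_r, neg_sin, neg_cos, IHs, IHc.
    simpl. split; at_R; ring.
Qed.

Lemma sine_mode_h h k : 0 < h -> sine_mode h k h = 0.
Proof.
  intros Hh. unfold sine_mode.
  replace (PI * INR k * h / h) with (PI * INR k) by (at_R; field; lra).
  apply sin_cos_nat_PI.
Qed.

Lemma cosine_mode_h h k : 0 < h -> cosine_mode h k h = (-1) ^ k.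
Proof.
  intros Hh. unfold cosine_mode.
  replace (PI * INR k * h / h) with (PI * INR k) by (at_R; field; lra).
  apply sin_cos_nat_PI.
Qed.

Lemma cosine_mode_0 h k : cosine_mode h k 0 = 1.
Proof. unfold cosine_mode, Rdiv. rewrite Rmult_0_r, Rmult_0_l. apply cos_0. Qed.

(** Chebyshev's recurrence. Read on coefficients, it says that multiplying a function by the first
    cosine averages the two neighbouring coefficients. *)
Lemma sine_mode_rec h k z :
  sine_mode h (S (S k)) z + sine_mode h k z
  = 2 * cosine_mode h 1 z * sine_mode h (S k) z.
Proof.
  unfold sine_mode, cosine_mode. change (INR 1) with 1. rewrite !S_INR.
  set (a := PI * (INR k + 1) * z / h). set (b := PI * 1 * z / h).
  replace (PI * (INR k + 1 + 1) * z / h) with (a + b) by (unfold a, b, Rdiv; ring).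
  replace (PI * INR k * z / h) with (a - b) by (unfold a, b, Rdiv; ring).
  rewrite sin_plus, sin_minus. ring.
Qed.

Lemma wavenumber_pos h k : 0 < h -> (0 < k)%nat -> 0 < wavenumber h k.
Proof.
  intros Hh Hk. apply Rdiv_lt_0_compat; [|easy].
  apply Rmult_lt_0_compat; [apply PI_RGT_0|now apply lt_0_INR].
Qed.

Lemma sine_mode_orthogonal h j k : 0 < h -> j <> k ->
  RInt (fun z => sine_mode h j z * sine_mode h k z) 0 h = 0.
Proof.
  intros Hh Hjk.
  set (D := wavenumber h j ^ 2 - wavenumber h k ^ 2).
  assert (HD : D <> 0).
  { unfold D, wavenumber. intros E. apply Hjk. apply INR_eq.
    assert (HPI := PI_RGT_0). assert (Hj := pos_INR j). assert (Hk := pos_INR k).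
    assert (E' : (INR j - INR k) * (INR j + INR k) = 0).
    { replace ((INR j - INR k) * (INR j + INR k))
        with (h ^ 2 / PI ^ 2 * ((PI * INR j / h) ^ 2 - (PI * INR k / h) ^ 2))
        by (at_R; field; lra).
      rewrite E. at_R; ring. }
    apply Rmult_integral in E' as [|]; lra. }
  apply (Rmult_eq_reg_l D); [|easy].
  rewrite Rmult_0_r, <- RInt_mult_l by (apply cont_ex_RInt; intros; cont).
  (* The Wronskian of the two modes is a primitive of D times their product, and it vanishes at both
     walls. *)
  rewrite (RInt_of_derive
    (fun z => sine_mode h j z * (wavenumber h k * cosine_mode h k z)
              - wavenumber h j * cosine_mode h j z * sine_mode h k z)).
  - rewrite !sine_mode_0, !sine_mode_h by easy. at_R; ring.
  - lra.
  - intros; cont.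
  - intros z _. unfold D.
    auto_derive.
    + repeat split; ex_derive_mode.
    + rewrite ?Derive_sine_mode, ?Derive_cosine_mode. at_R; ring.
  - intros; cont.
Qed.

Lemma sine_mode_norm h k : 0 < h -> (0 < k)%nat ->
  RInt (fun z => sine_mode h k z * sine_mode h k z) 0 h = h / 2.
Proof.
  intros Hh Hk. assert (Hw := wavenumber_pos h k Hh Hk).
  rewrite (RInt_of_derive
    (fun z => z / 2 - sine_mode h k z * cosine_mode h k z / (2 * wavenumber h k))).
  - rewrite sine_mode_0, sine_mode_h by easy. at_R; field. lra.
  - lra.
  - intros; unfold Rdiv; cont.
  - intros z _.
    auto_derive.
    + repeat split; ex_derive_mode.
    + rewrite ?Derive_sine_mode, ?Derive_cosine_mode.
      assert (E : sine_mode h k z ^ 2 + cosine_mode h k z ^ 2 = 1).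
      { rewrite <- !Rsqr_pow2. apply sin2_cos2. }
      apply (Rmult_eq_reg_r (wavenumber h k)); [|lra]. field_simplify; [|lra..].
      replace (cosine_mode h k z ^ 2) with (1 - sine_mode h k z ^ 2) by lra. at_R; field.
  - intros; cont.
Qed.

(** Origin of the coefficient in the kernel: multiplied by - 2 / h this mean becomes 2 ((-1)^k - 1)
    / (k pi). *)
Lemma sine_mode_mean h k : 0 < h -> (0 < k)%nat ->
  RInt (sine_mode h k) 0 h = h * (1 - (-1) ^ k) / (INR k * PI).
Proof.
  intros Hh Hk. assert (Hw := wavenumber_pos h k Hh Hk).
  rewrite (RInt_of_derive (fun z => - cosine_mode h k z / wavenumber h k)).
  - rewrite cosine_mode_0, cosine_mode_h by easy. unfold wavenumber. at_R; field.
    apply lt_0_INR in Hk. assert (HPI := PI_RGT_0). repeat split; lra.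
  - lra.
  - intros; unfold Rdiv; cont.
  - intros z _.
    auto_derive.
    + ex_derive_mode.
    + rewrite ?Derive_sine_mode, ?Derive_cosine_mode. at_R; field. lra.
  - intros; cont.
Qed.

Lemma sine_coef_lin h (f g : R -> R) al be k :
  (forall z, continuous f z) -> (forall z, continuous g z) ->
  sine_coef h (fun z => al * f z + be * g z) k
  = al * sine_coef h f k + be * sine_coef h g k.
Proof.
  intros Hf Hg. unfold sine_coef. rewrite <- RInt_lin by (apply cont_ex_RInt; intros; cont).
  apply RInt_ext. intros. at_R; ring.
Qed.

(** One Gram-Schmidt step with Pythagoras' identity. The factor 2 / h is the inverse of the squared
    norm of a mode. *)
Lemma sine_projection_step h (r : R -> R) j : 0 < h -> (0 < j)%nat ->
  (forall z, continuous r z) ->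
  let r' := fun z => 1 * r z + - (2 / h * sine_coef h r j) * sine_mode h j z in
  (forall i, i <> j -> sine_coef h r' i = sine_coef h r i) /\
  RInt (fun z => r' z * r' z) 0 h
  = RInt (fun z => r z * r z) 0 h - 2 / h * sine_coef h r j ^ 2.
Proof.
  intros Hh Hj Hr r'. split.
  - intros i Hi. unfold r'. rewrite sine_coef_lin; [|easy|intros; cont].
    unfold sine_coef at 3. rewrite sine_mode_orthogonal by auto. at_R; ring.
  - set (c := sine_coef h r j) in *. set (e := 2 / h * c) in *.
    rewrite (RInt_ext _ (fun z => 1 * (1 * (r z * r z)
      + (- 2 * e) * (r z * sine_mode h j z)) + e ^ 2 * (sine_mode h j z * sine_mode h j z)))
      by (intros; unfold r'; at_R; ring).
    rewrite RInt_lin by (apply cont_ex_RInt; intros; cont).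
    rewrite RInt_lin by (apply cont_ex_RInt; intros; cont).
    rewrite sine_mode_norm by easy. fold (sine_coef h r j). fold c.
    unfold e. at_R; field. lra.
Qed.

Lemma sine_bessel h (g : R -> R) N : 0 < h -> (forall z, continuous g z) ->
  2 / h * sum_n (fun n => sine_coef h g (S n) ^ 2) N
  <= RInt (fun z => g z * g z) 0 h.
Proof.
  intros Hh Hg.
  (* Here r is the remainder of g after modes 1 to N + 1 have been projected out. The induction has
     to carry along that the later coefficients are still those of g; Bessel's inequality is then
     the nonnegativity of the integral of r^2. *)
  assert (H : exists r : R -> R, (forall z, continuous r z) /\
    (forall i, (S N < i)%nat -> sine_coef h r i = sine_coef h g i) /\
    RInt (fun z => r z * r z) 0 h
    = RInt (fun z => g z * g z) 0 h
      - 2 / h * sum_n (fun n => sine_coef h g (S n) ^ 2) N).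
  { induction N as [|N [r [Hr [Hc Hi]]]].
    - destruct (sine_projection_step h g 1 Hh) as [H1 H2]; [lia|easy|].
      eexists. split; [|split; [|rewrite sum_O; exact H2]].
      + intros; cont.
      + intros i Hi. apply H1. lia.
    - destruct (sine_projection_step h r (S (S N)) Hh) as [H1 H2]; [lia|easy|].
      exists (fun z => 1 * r z
        + - (2 / h * sine_coef h r (S (S N))) * sine_mode h (S (S N)) z).
      split; [|split; [|rewrite H2, Hi, sum_n_S, (Hc (S (S N))) by lia]].
      + intros; cont.
      + intros i Hi'. rewrite H1 by lia. apply Hc. lia.
      + simpl. at_R; ring. }
  destruct H as [r [Hr [_ HI]]].
  assert (0 <= RInt (fun z => r z * r z) 0 h).
  { apply RInt_ge_0; [lra|apply cont_ex_RInt; intros; cont|].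
    intros x _. apply Rle_0_sqr. }
  lra.
Qed.

Lemma le_plus_nonneg a b : 0 <= b -> a <= a + b.
Proof. lra. Qed.

Lemma sum_n_single_le (a : nat -> R) n :
  (forall i, 0 <= a i) -> a n <= sum_n a n.
Proof.
  intros Ha. destruct n; [rewrite sum_O; lra|].
  rewrite sum_n_S. simpl.
  assert (0 <= sum_n a n); [|lra].
  induction n; [rewrite sum_O; apply Ha|].
  rewrite sum_n_S. simpl. specialize (Ha (S n)). lra.
Qed.

Lemma sine_coef_sqr_le h (g : R -> R) k : 0 < h -> (forall z, continuous g z) ->
  sine_coef h g k ^ 2 <= h / 2 * RInt (fun z => g z * g z) 0 h.
Proof.
  intros Hh Hg.
  assert (H0 : 0 <= RInt (fun z => g z * g z) 0 h).
  { apply RInt_ge_0; [lra|apply cont_ex_RInt; intros; cont|].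
    intros x _. apply Rle_0_sqr. }
  destruct k as [|k].
  - unfold sine_coef. rewrite (RInt_ext _ (fun _ => 0)), RInt_cst.
    + rewrite Rmult_0_r. replace (0 ^ 2) with 0 by (at_R; ring).
      apply Rmult_le_pos; lra.
    + intros z _. rewrite sine_mode_O. at_R; ring.
  - assert (H1 := sine_bessel h g k Hh Hg).
    assert (H2 := sum_n_single_le (fun n => sine_coef h g (S n) ^ 2) k
                    (fun i => pow2_ge_0 _)). simpl in H2.
    replace (sine_coef h g (S k) ^ 2)
      with (h / 2 * (2 / h * sine_coef h g (S k) ^ 2)) by (at_R; field; lra).
    apply Rmult_le_compat_l; [lra|].
    eapply Rle_trans; [|exact H1]. apply Rmult_le_compat_l; [|exact H2].
    left. apply Rdiv_lt_0_compat; lra.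
Qed.

(** By Bessel's inequality the squared coefficients are summable, so they tend to 0. *)
Lemma sine_riemann_lebesgue h (g : R -> R) : 0 < h -> (forall z, continuous g z) ->
  is_lim_seq (fun n => sine_coef h g (S n)) 0.
Proof.
  intros Hh Hg.
  assert (Hs : ex_series (fun n => sine_coef h g (S n) ^ 2)).
  { edestruct ex_finite_lim_seq_incr
      with (M := h / 2 * RInt (fun z => g z * g z) 0 h) as [l Hl];
      [| |exists l; exact Hl].
    - intros n. rewrite sum_n_S.
      apply le_plus_nonneg, pow2_ge_0.
    - intros n. assert (H := sine_bessel h g n Hh Hg).
      apply (Rmult_le_reg_l (2 / h)); [apply Rdiv_lt_0_compat; lra|].
      eapply Rle_trans; [exact H|]. right. symmetry. at_R. field. lra. }
  apply ex_series_lim_0 in Hs.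
  apply is_lim_seq_spec in Hs. apply is_lim_seq_spec. intros eps.
  assert (He : 0 < eps * eps) by (apply Rmult_lt_0_compat; apply eps).
  destruct (Hs (mkposreal _ He)) as [N HN]. exists N. intros n Hn.
  specialize (HN n Hn). simpl pos in HN. rewrite Rminus_0_r in *.
  rewrite Rabs_pos_eq in HN by apply pow2_ge_0.
  apply Rnot_le_lt. intros Hle. apply (Rlt_not_le _ _ HN).
  rewrite <- pow2_abs. simpl. rewrite Rmult_1_r.
  assert (Hp := cond_pos eps). apply Rmult_le_compat; lra.
Qed.

(** The quotient by x - a with the removable singularity filled in by l; it is continuous at a
    exactly when l is the derivative there. *)
Definition slope (f : R -> R) (a l x : R) : R :=
  if Req_EM_T x a then l else (f x - f a) / (x - a).

Lemma slope_spec f a l x : f x - f a = (x - a) * slope f a l x.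
Proof.
  unfold slope. destruct (Req_EM_T x a) as [->|H]; [ring|]. field. lra.
Qed.

Lemma cont_slope (f : R -> R) a l :
  (forall x, continuous f x) -> is_derive f a l ->
  forall x, continuous (slope f a l) x.
Proof.
  intros Hf Hd x. destruct (Req_EM_T x a) as [->|Hx].
  - apply filterlim_locally. intros eps.
    apply is_derive_Reals in Hd. destruct (Hd eps (cond_pos eps)) as [d Hd'].
    exists d. intros y Hy. change (Rabs (y - a) < d) in Hy.
    change (Rabs (slope f a l y - slope f a l a) < eps). unfold slope.
    destruct (Req_EM_T a a) as [_|]; [|easy].
    destruct (Req_EM_T y a) as [_|Hya].
    + rewrite Rminus_diag, Rabs_R0. apply eps.
    + specialize (Hd' (y - a)). rewrite Rplus_minus in Hd'.
      apply Hd'; [lra|easy].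
  - apply (continuous_ext_loc _ (fun y => (f y - f a) * / (y - a))).
    + assert (Hp : 0 < Rabs (x - a)) by (apply Rabs_pos_lt; lra).
      exists (mkposreal _ Hp). intros y Hy. change (Rabs (y - x) < Rabs (x - a)) in Hy.
      unfold slope. destruct (Req_EM_T y a) as [->|]; [|easy].
      rewrite Rabs_minus_sym in Hy. lra.
    + apply cont_mult; [cont|]. apply cont_of_derivable. auto_derive. lra.
Qed.

Lemma continuous_div (f g : R -> R) x :
  continuous f x -> continuous g x -> g x <> 0 ->
  continuous (fun y => f y / g y) x.
Proof.
  intros Hf Hg H0. apply cont_mult; [easy|].
  apply (continuous_comp g Rinv); [easy|].
  apply cont_of_derivable. auto_derive. easy.
Qed.

Lemma sine_mode_1_pos h z : 0 < z < h -> 0 < sine_mode h 1 z.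
Proof.
  intros Hz. unfold sine_mode. simpl INR. rewrite Rmult_1_r.
  assert (HPI := PI_RGT_0). apply sin_gt_0.
  - apply Rdiv_lt_0_compat; [apply Rmult_lt_0_compat|]; lra.
  - apply (Rmult_lt_reg_r h); [lra|]. unfold Rdiv.
    rewrite Rmult_assoc, Rinv_l, Rmult_1_r by lra. apply Rmult_lt_compat_l; lra.
Qed.

Lemma sum_n_zero (a : nat -> R) N : (forall n, a n = 0) -> sum_n a N = 0.
Proof.
  intros Ha. induction N as [|N IH]; [now rewrite sum_O|].
  rewrite sum_n_S, IH, Ha. simpl. lra.
Qed.

Lemma sine_series_vanishing h (f : R -> R) z0 : 0 < h -> 0 < z0 < h ->
  (forall z, continuous f z) -> ex_derive f z0 -> f z0 = 0 ->
  is_lim_seq (sum_n (fun n => sine_coef h f (S n) * sine_mode h (S n) z0)) 0.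
Proof.
  intros Hh Hz0 Hf [l Hl] Hfz.
  (* Chernoff's argument: f = (cos (pi z / h) - cos (pi z0 / h)) g with g
     continuous, and both z0-modes and z-modes satisfy [sine_mode_rec], so the
     partial sums telescope into a discrete Wronskian. *)
  set (w := wavenumber h 1). assert (Hw : 0 < w) by (apply wavenumber_pos; [easy|lia]).
  assert (Harg : forall z, PI * INR 1 * z / h = w * z)
    by (intros; unfold w, wavenumber; field; lra).
  assert (HwPI : w * h = PI) by (unfold w, wavenumber; simpl; field; lra).
  set (q := slope f z0 l).
  set (r := slope (cosine_mode h 1) z0 (- (w * sine_mode h 1 z0))).
  assert (Hq : forall z, continuous q z) by now apply cont_slope.
  assert (Hr : forall z, continuous r z).
  { apply cont_slope; [intros; cont|apply is_derive_cosine_mode]. }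
  (* At z0 the value is the derivative - w sin (w z0), which is not 0 inside the channel; elsewhere
     the cosine is injective on [0, pi]. *)
  assert (Hr0 : forall z, 0 <= z <= h -> r z <> 0).
  { intros z Hz E.
    assert (Hin : forall y, 0 <= y <= h -> 0 <= w * y <= PI).
    { intros y Hy. split; [apply Rmult_le_pos; lra|].
      rewrite <- HwPI. apply Rmult_le_compat_l; lra. }
    destruct (Req_dec z z0) as [->|Hne].
    - revert E. unfold r, slope. destruct (Req_EM_T z0 z0) as [_|]; [|easy].
      unfold sine_mode. rewrite Harg.
      assert (0 < w * z0) by (apply Rmult_lt_0_compat; lra).
      assert (w * z0 < PI) by (rewrite <- HwPI; apply Rmult_lt_compat_l; lra).
      assert (0 < sin (w * z0)) by (apply sin_gt_0; lra).
      intros E. assert (0 < w * sin (w * z0)) by (apply Rmult_lt_0_compat; lra).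
      lra.
    - assert (Hs := slope_spec (cosine_mode h 1) z0 (- (w * sine_mode h 1 z0)) z).
      fold r in Hs. rewrite E, Rmult_0_r in Hs. unfold cosine_mode in Hs.
      rewrite !Harg in Hs.
      assert (H1 := Hin z Hz). assert (H2 : 0 <= w * z0 <= PI) by (apply Hin; lra).
      destruct (Rlt_or_le z z0) as [Hlt|Hle].
      + assert (w * z < w * z0) by (apply Rmult_lt_compat_l; lra).
        assert (cos (w * z0) < cos (w * z)) by (apply cos_decreasing_1; lra). lra.
      + assert (w * z0 < w * z) by (apply Rmult_lt_compat_l; lra).
        assert (cos (w * z) < cos (w * z0)) by (apply cos_decreasing_1; lra). lra. }
  (* Off [0, h] the cosine takes its value at z0 again and r has zeros; clamping keeps the quotient
     continuous on the whole line. *)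
  set (g := fun z => q (clamp 0 h z) / r (clamp 0 h z)).
  assert (Hcl : forall z, continuous (clamp 0 h) z) by apply cont_clamp.
  assert (Hg : forall z, continuous g z).
  { intros z. apply (continuous_div (fun z => q (clamp 0 h z)) (fun z => r (clamp 0 h z)));
      [cont|cont|]. apply Hr0. apply clamp_in. lra. }
  assert (Hfg : forall z, 0 <= z <= h ->
    f z = (cosine_mode h 1 z - cosine_mode h 1 z0) * g z).
  { intros z Hz. unfold g. rewrite clamp_id by easy.
    assert (H1 := slope_spec f z0 l z).
    assert (H2 := slope_spec (cosine_mode h 1) z0 (- (w * sine_mode h 1 z0)) z).
    fold q in H1. fold r in H2. rewrite H2. rewrite Hfz in H1.
    replace (f z) with (f z - 0) by ring. rewrite H1. field. now apply Hr0. }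
  set (c0 := cosine_mode h 1 z0).
  (* The factor cos (pi z / h) - c0 acts on coefficients through [sine_mode_rec]. The index n = 0
     fits in because mode 0 is identically zero. *)
  assert (Hcoef : forall n, sine_coef h f (S n)
    = / 2 * (sine_coef h g (S (S n)) + sine_coef h g n) - c0 * sine_coef h g (S n)).
  { intros n.
    replace (/ 2 * (sine_coef h g (S (S n)) + sine_coef h g n) - c0 * sine_coef h g (S n))
      with (1 * (/ 2 * sine_coef h g (S (S n)) + / 2 * sine_coef h g n)
            + (- c0) * sine_coef h g (S n)) by ring.
    unfold sine_coef.
    rewrite <- RInt_lin by (apply cont_ex_RInt; intros; cont).
    rewrite <- RInt_lin by (apply cont_ex_RInt; intros; cont).
    apply RInt_ext. intros z Hz. rewrite Rmin_left, Rmax_right in Hz by lra.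
    rewrite Hfg by lra. fold c0.
    assert (H := sine_mode_rec h n z). at_R.
    replace (sine_mode h (S (S n)) z)
      with (2 * cosine_mode h 1 z * sine_mode h (S n) z - sine_mode h n z) by lra.
    field. }
  assert (Hsum : forall N,
    sum_n (fun n => sine_coef h f (S n) * sine_mode h (S n) z0) N
    = / 2 * (sine_mode h (S N) z0 * sine_coef h g (S (S N))
             - sine_mode h (S (S N)) z0 * sine_coef h g (S N))).
  { induction N as [|N IH].
    - rewrite sum_O, Hcoef.
      assert (H := sine_mode_rec h 0 z0). fold c0 in H. rewrite sine_mode_O in H.
      assert (H0 : sine_coef h g 0 = 0).
      { unfold sine_coef. rewrite (RInt_ext _ (fun _ => 0)), RInt_cst; [at_R; ring|].
        intros z _. rewrite sine_mode_O. at_R; ring. }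
      rewrite H0. replace (sine_mode h 2 z0) with (2 * c0 * sine_mode h 1 z0) by lra.
      at_R; field.
    - rewrite sum_n_S, IH, Hcoef.
      assert (H := sine_mode_rec h (S N) z0). fold c0 in H.
      replace (sine_mode h (S (S (S N))) z0)
        with (2 * c0 * sine_mode h (S (S N)) z0 - sine_mode h (S N) z0) by lra.
      simpl. at_R; field. }
  apply (is_lim_seq_ext (fun N => / 2 * (sine_mode h (S N) z0 * sine_coef h g (S (S N))
             - sine_mode h (S (S N)) z0 * sine_coef h g (S N))));
    [intros; symmetry; apply Hsum|].
  assert (HL := sine_riemann_lebesgue h g Hh Hg).
  assert (HL' := HL).
  apply (proj1 (is_lim_seq_incr_1 (fun n => sine_coef h g (S n)) 0)) in HL'.
  apply is_lim_seq_abs_0.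
  (* In the telescoped form the modes are at most 1 in absolute value, and both coefficients of g
     tend to 0 by the Riemann-Lebesgue lemma. *)
  apply is_lim_seq_le_le with (u := fun _ => 0)
    (w := fun N => / 2 * (Rabs (sine_coef h g (S (S N))) + Rabs (sine_coef h g (S N)))).
  - intros N. split; [apply Rabs_pos|].
    rewrite Rabs_mult, (Rabs_pos_eq (/ 2)) by lra.
    apply Rmult_le_compat_l; [lra|].
    eapply Rle_trans; [apply Rabs_triang|]. rewrite Rabs_Ropp, !Rabs_mult.
    assert (Hb : forall k, Rabs (sine_mode h k z0) <= 1)
      by (intros; apply Rabs_le, SIN_bound).
    assert (Hb' : forall k j, Rabs (sine_mode h k z0) * Rabs (sine_coef h g j)
      <= Rabs (sine_coef h g j)).
    { intros k j. rewrite <- (Rmult_1_l (Rabs (sine_coef h g j))) at 2.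
      apply Rmult_le_compat_r; [apply Rabs_pos|apply Hb]. }
    apply Rplus_le_compat; apply Hb'.
  - apply is_lim_seq_const.
  - replace (Finite 0) with (Finite (/ 2 * (Rabs 0 + Rabs 0)))
      by (rewrite Rabs_R0; f_equal; ring).
    apply (is_lim_seq_scal_l _ (/ 2) (Finite (Rabs 0 + Rabs 0))).
    apply is_lim_seq_plus'; [apply (is_lim_seq_abs _ 0)|apply (is_lim_seq_abs _ 0)]; easy.
Qed.

(** At a wall every term is zero. Inside, subtracting the right multiple of the first mode makes f
    vanish at z and changes the first coefficient only, which reduces the claim to
    [sine_series_vanishing]. *)
Lemma sine_series h (f : R -> R) z : 0 < h -> 0 <= z <= h ->
  (forall y, continuous f y) -> f 0 = 0 -> f h = 0 ->
  (0 < z < h -> ex_derive f z) ->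
  is_lim_seq (sum_n (fun n => 2 / h * sine_coef h f (S n) * sine_mode h (S n) z)) (f z).
Proof.
  intros Hh Hz Hf Hf0 Hfh Hd.
  assert (Hend : (forall k, sine_mode h k z = 0) -> f z = 0 ->
    is_lim_seq (sum_n (fun n => 2 / h * sine_coef h f (S n) * sine_mode h (S n) z)) (f z)).
  { intros Hs ->. apply (is_lim_seq_ext (fun _ => 0)); [|apply is_lim_seq_const].
    intros N. symmetry. apply sum_n_zero. intros n. rewrite Hs. ring. }
  destruct (Req_dec z 0) as [->|H0]; [apply Hend; [intros; apply sine_mode_0|easy]|].
  destruct (Req_dec z h) as [->|H1]; [apply Hend; [intros; now apply sine_mode_h|easy]|].
  assert (Hzin : 0 < z < h) by lra. clear Hend.
  assert (Hs : sine_mode h 1 z <> 0) by now apply Rgt_not_eq, sine_mode_1_pos.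
  set (A := f z / sine_mode h 1 z).
  set (f1 := fun y => 1 * f y + (- A) * sine_mode h 1 y).
  assert (Hlim := sine_series_vanishing h f1 z Hh Hzin).
  assert (Hf1 : forall k, (0 < k)%nat -> sine_coef h f1 k
    = sine_coef h f k - (if Nat.eqb k 1 then A * (h / 2) else 0)).
  { intros k Hk. unfold f1. rewrite sine_coef_lin; [|easy|intros; cont].
    unfold sine_coef at 2. destruct (Nat.eqb_spec k 1) as [->|Hk1].
    - rewrite sine_mode_norm by easy. at_R; ring.
    - rewrite sine_mode_orthogonal by auto. at_R; ring. }
  (* The subtracted mode contributes 2 / h times A h / 2 times the first mode at z, which is f z. *)
  assert (Hsum : forall N,
    sum_n (fun n => 2 / h * sine_coef h f (S n) * sine_mode h (S n) z) N
    = 2 / h * sum_n (fun n => sine_coef h f1 (S n) * sine_mode h (S n) z) N + f z).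
  { induction N as [|N IH].
    - rewrite !sum_O, Hf1 by lia. simpl. unfold A. at_R; field. lra.
    - rewrite !sum_n_S, IH, Hf1 by lia. simpl. at_R; ring. }
  apply (is_lim_seq_ext _ _ _ (fun N => eq_sym (Hsum N))).
  replace (Finite (f z)) with (Finite (2 / h * 0 + f z)) by (f_equal; ring).
  apply is_lim_seq_plus'; [|apply is_lim_seq_const].
  apply (is_lim_seq_scal_l _ (2 / h) 0). apply Hlim.
  - intros; unfold f1; cont.
  - destruct (Hd Hzin) as [l Hl]. eexists.
    apply (is_derive_plus (fun y => 1 * f y) (fun y => - A * sine_mode h 1 y)).
    + apply (is_derive_scal f z 1 l Hl).
    + apply (is_derive_scal (sine_mode h 1) z (- A)), is_derive_sine_mode.
  - unfold f1, A. field. easy.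
Qed.

(** * Ancient periodic solutions *)

Lemma periodic_reduce (f : R -> R) L : 0 < L -> (forall x, f (x + L) = f x) ->
  forall x, exists y, 0 <= y <= L /\ f x = f y.
Proof.
  intros HL Hf.
  assert (Hn : forall n x, f (x + INR n * L) = f x).
  { induction n as [|n IH]; intros x.
    - simpl. f_equal. ring.
    - rewrite S_INR. rewrite <- (IH x), <- (Hf (x + INR n * L)). f_equal. ring. }
  assert (Hz : forall n x, f (x + IZR n * L) = f x).
  { intros n x. destruct (Z.le_gt_cases 0 n) as [H|H].
    - rewrite <- (Z2Nat.id n H), <- INR_IZR_INZ. apply Hn.
    - rewrite <- (Hn (Z.to_nat (- n)) (x + IZR n * L)). f_equal.
      rewrite INR_IZR_INZ, Z2Nat.id by lia. rewrite opp_IZR. ring. }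
  intros x. destruct (base_Int_part (x / L)) as [H1 H2].
  set (n := Int_part (x / L)) in *.
  assert (Hx : x = x / L * L) by (field; lra).
  exists (x + IZR (- n) * L). rewrite Hz. split; [|easy].
  rewrite opp_IZR. rewrite Hx at 1 2.
  replace (x / L * L + - IZR n * L) with ((x / L - IZR n) * L) by ring.
  split; [apply Rmult_le_pos; lra|].
  apply Rle_trans with (1 * L); [|lra]. apply Rmult_le_compat_r; lra.
Qed.

Lemma derive_nonpos_decr (f df : R -> R) a b :
  a <= b -> (forall x, is_derive f x (df x)) -> (forall x, df x <= 0) -> f b <= f a.
Proof.
  intros Hab Hd Hn.
  destruct (MVT_gen f a b df) as [c [_ Hc]].
  - intros x _; apply Hd.
  - intros x _. apply continuity_pt_filterlim.
    apply cont_of_derivable. now exists (df x).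
  - assert (df c * (b - a) <= 0) by (specialize (Hn c); nra). lra.
Qed.

(** Since exp (kappa t) F t is nonincreasing, a positive value of F would have to grow exponentially
    backwards in time, against the bound M. *)
Lemma ancient_decay (kappa M : R) (F D : R -> R) :
  0 < kappa -> (forall t, is_derive F t (D t - kappa * F t)) ->
  (forall t, D t <= 0) -> (forall t, F t <= M) -> forall t, F t <= 0.
Proof.
  intros Hk HF HD HM t. apply Rnot_lt_le. intros Hpos.
  (* M' is positive and exceeds M. The delay d solves kappa d F(t) = M', so exp x > x at x = kappa d
     already gives F(t - d) > M'. *)
  set (M' := Rabs M + 1). assert (HM' : M < M') by (generalize (Rle_abs M); unfold M'; lra).
  assert (HM0 : 0 < M') by (generalize (Rabs_pos M); unfold M'; lra).
  set (d := M' / (kappa * F t)).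
  assert (Hd : 0 < d) by (apply Rdiv_lt_0_compat; [easy|now apply Rmult_lt_0_compat]).
  assert (HG : exp (kappa * t) * F t <= exp (kappa * (t - d)) * F (t - d)).
  { apply (derive_nonpos_decr (fun s => exp (kappa * s) * F s)
             (fun s => exp (kappa * s) * D s)); [lra| |].
    - intros s. assert (E := is_derive_unique _ _ _ (HF s)).
      auto_derive; [eexists; apply HF|].
      change (fun x => F x) with F. rewrite E. ring.
    - intros s. generalize (exp_pos (kappa * s)) (HD s). nra. }
  assert (HG' : exp (kappa * d) * F t <= F (t - d)).
  { apply (Rmult_le_reg_l (exp (kappa * (t - d)))); [apply exp_pos|].
    rewrite <- Rmult_assoc, <- exp_plus.
    replace (kappa * (t - d) + kappa * d) with (kappa * t) by ring. easy. }
  assert (He : kappa * d < exp (kappa * d)).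
  { assert (0 < kappa * d) by now apply Rmult_lt_0_compat.
    generalize (exp_ineq1 (kappa * d)). lra. }
  assert (kappa * d * F t = M').
  { unfold d. field. split; lra. }
  specialize (HM (t - d)). nra.
Qed.

(* The variance L * int c^2 - (int c)^2 over one period does not see the
   spatially constant forcing, and decays at the rate [2 nu lam]. *)
Lemma ancient_periodic_constant (nu lam L : R) (g : R -> R) (c ct cx cxx : R -> R -> R) :
  0 < nu -> 0 < lam -> 0 < L ->
  cont2 c -> cont2 ct -> cont2 cx -> cont2 cxx ->
  (forall x t, is_derive (fun s => c x s) t (ct x t)) ->
  (forall x t, is_derive (fun y => c y t) x (cx x t)) ->
  (forall x t, is_derive (fun y => cx y t) x (cxx x t)) ->
  (forall x t, ct x t = nu * cxx x t - nu * lam * c x t - g t) ->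
  (forall x t, c (x + L) t = c x t) ->
  (exists M, forall t, RInt (fun x => c x t * c x t) 0 L <= M) ->
  forall x t, c x t = c 0 t.
Proof.
  intros Hnu Hlam HL Cc Cct Ccx Ccxx Ht Hx Hxx Heq Hper [M HM].
  (* Periodicity passes from c to cx, so the boundary terms of the integrations in x cancel. *)
  assert (Hperx : forall t, cx L t = cx 0 t).
  { intros t. rewrite <- (is_derive_unique _ _ _ (Hx 0 t)).
    rewrite <- (Derive_ext (fun y => c (y + L) t)) by (intros; apply Hper).
    symmetry. apply is_derive_unique.
    replace (cx L t) with (1 * cx (0 + L) t) by (rewrite Rplus_0_l; ring).
    apply (is_derive_comp (fun y => c y t) (fun y => y + L)); [apply Hx|].
    auto_derive; [easy|ring]. }
  set (I1 := (fun t => RInt (fun x => c x t) 0 L) : R -> R).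
  set (I2 := (fun t => RInt (fun x => c x t * c x t) 0 L) : R -> R).
  set (J := (fun t => RInt (fun x => c x t * cxx x t) 0 L) : R -> R).
  assert (HI1 : forall t, is_derive I1 t (- (nu * lam) * I1 t - L * g t)).
  { intros t.
    replace (- (nu * lam) * I1 t - L * g t) with (RInt (fun x => ct x t) 0 L).
    - apply (is_derive_RInt_parameter (fun t x => c x t) (fun t x => ct x t));
        intros; [apply Ht|cont|cont].
    - rewrite (RInt_ext _ (fun x => 1 * (nu * cxx x t + - (nu * lam) * c x t) + (- g t) * 1))
        by (intros; rewrite Heq; at_R; ring).
      rewrite RInt_lin by integrable. rewrite RInt_lin by integrable.
      rewrite (RInt_of_derive (fun y => cx y t) (fun y => cxx y t));
        [|lra|intros; cont|intros; apply Hxx|intros; cont].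
      rewrite Hperx, RInt_cst. fold (I1 t). at_R; ring. }
  assert (HI2 : forall t,
    is_derive I2 t (2 * nu * J t - 2 * (nu * lam) * I2 t - 2 * g t * I1 t)).
  { intros t.
    replace (2 * nu * J t - 2 * (nu * lam) * I2 t - 2 * g t * I1 t)
      with (RInt (fun x => 2 * c x t * ct x t) 0 L).
    - apply (is_derive_RInt_parameter (fun t x => c x t * c x t)
               (fun t x => 2 * c x t * ct x t)); intros; [|cont|cont].
      assert (E : Derive (fun s => c z s) s = ct z s) by apply is_derive_unique, Ht.
      auto_derive; [known Ht|]. rewrite E. ring.
    - rewrite (RInt_ext _ (fun x => 1 * (2 * nu * (c x t * cxx x t)
          + - (2 * (nu * lam)) * (c x t * c x t)) + - (2 * g t) * c x t))
        by (intros; rewrite Heq; at_R; ring).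
      rewrite RInt_lin by integrable. rewrite RInt_lin by integrable.
      fold (I1 t) (I2 t) (J t). at_R; ring. }
  (* Integration by parts over a period: J is minus the integral of cx^2. *)
  assert (HJ : forall t, J t <= 0).
  { intros t.
    assert (E : 1 * J t + 1 * RInt (fun x => cx x t * cx x t) 0 L = 0).
    { unfold J. rewrite <- RInt_lin by integrable.
      rewrite (RInt_of_derive (fun x => c x t * cx x t)).
      - rewrite Hperx. replace (c L t) with (c 0 t); [at_R; ring|].
        rewrite <- (Hper 0 t). f_equal. ring.
      - lra.
      - intros; cont.
      - intros x _. assert (E1 : Derive (fun y => c y t) x = cx x t) by apply is_derive_unique, Hx.
        assert (E2 : Derive (fun y => cx y t) x = cxx x t) by apply is_derive_unique, Hxx.
        auto_derive; [split; [known Hx|known Hxx]|].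
        rewrite E1, E2. ring.
      - intros; cont. }
    assert (0 <= RInt (fun x => cx x t * cx x t) 0 L).
    { apply RInt_ge_0; [lra|integrable|]. intros; apply Rle_0_sqr. }
    lra. }
  (* The forcing enters the derivative as - 2 L g I1 through L I2 and as + 2 L g I1 through - I1^2,
     so it cancels; what remains besides the damping is 2 nu L J, which is nonpositive. *)
  assert (HF : forall t, L * I2 t - I1 t * I1 t <= 0).
  { apply (ancient_decay (2 * (nu * lam)) (L * M)
             (fun t => L * I2 t - I1 t * I1 t) (fun t => 2 * nu * L * J t)).
    - repeat apply Rmult_lt_0_compat; lra.
    - intros t. assert (E1 := is_derive_unique _ _ _ (HI1 t)).
      assert (E2 := is_derive_unique _ _ _ (HI2 t)).
      auto_derive; [split; [known HI2|known HI1]|].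
      change (fun x => I1 x) with I1. change (fun x => I2 x) with I2.
      rewrite E1, E2. ring.
    - intros t. specialize (HJ t).
      assert (0 < 2 * nu * L) by (repeat apply Rmult_lt_0_compat; lra). nra.
    - intros t. specialize (HM t). fold (I2 t) in HM.
      assert (L * I2 t <= L * M) by (apply Rmult_le_compat_l; lra).
      generalize (Rle_0_sqr (I1 t)). unfold Rsqr. lra. }
  (* The integral of (L c - I1)^2 over the period equals L (L I2 - I1^2), hence is at most 0, and
     the integrand vanishes. *)
  assert (Hc : forall t x, 0 <= x <= L -> L * c x t = I1 t).
  { intros t x Hx0. apply Rminus_diag_uniq.
    apply Rsqr_0_uniq.
    apply (RInt_nonneg_zero (fun x => (L * c x t - I1 t)²) 0 L); [easy| | | |easy].
    - intros; unfold Rsqr; cont.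
    - intros; apply Rle_0_sqr.
    - rewrite (RInt_ext _ (fun x => 1 * (L ^ 2 * (c x t * c x t)
          + - (2 * L * I1 t) * c x t) + (I1 t * I1 t) * 1))
        by (intros; unfold Rsqr; at_R; ring).
      rewrite RInt_lin by integrable. rewrite RInt_lin by integrable.
      rewrite RInt_cst. fold (I1 t) (I2 t).
      specialize (HF t). assert (L * (L * I2 t - I1 t * I1 t) <= 0) by nra.
      eapply Rle_trans; [|exact H]. right. at_R; ring. }
  intros x t.
  destruct (periodic_reduce (fun y => c y t) L HL (fun y => Hper y t) x) as [y [Hy ->]].
  apply (Rmult_eq_reg_l L); [|lra]. rewrite !Hc; lra.
Qed.

(** * The heat kernel series *)

Lemma exp_le_compat x y : x <= y -> exp x <= exp y.
Proof. intros [H| ->]; [left; now apply exp_increasing|apply Rle_refl]. Qed.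

Lemma exp_INR_mult n x : exp (INR n * x) = exp x ^ n.
Proof.
  induction n as [|n IH].
  - simpl. rewrite Rmult_0_l. apply exp_0.
  - rewrite S_INR, Rmult_plus_distr_r, exp_plus, IH, Rmult_1_l. simpl. ring.
Qed.

Lemma lim_seq_le_const (u : nat -> R) (l b : R) :
  (forall n, u n <= b) -> is_lim_seq u l -> l <= b.
Proof.
  intros Hu Hl. exact (is_lim_seq_le u (fun _ => b) l b Hu Hl (is_lim_seq_const b)).
Qed.

(** Summation by parts: the increments of T - w s are (w m - w (m + 1)) s m, so their total is at
    most E (w M - w (M + k)). The two boundary terms add E w (M + k) and E w M, which makes exactly
    2 E w M. *)
Lemma abel_tail_bound (w e : nat -> R) (E : R) :
  (forall n, 0 <= w n) -> (forall n, w (S n) <= w n) ->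
  (forall N, Rabs (sum_n e N) <= E) ->
  forall M k, Rabs (sum_n (fun n => w n * e n) (M + k) - sum_n (fun n => w n * e n) M)
              <= 2 * E * w M.
Proof.
  intros Hw Hd HE M k.
  set (s := (fun N => sum_n e N) : nat -> R).
  set (T := (fun N => sum_n (fun n => w n * e n) N) : nat -> R).
  assert (Hs : forall N, s (S N) = s N + e (S N)) by (intros; unfold s; now rewrite sum_n_S).
  assert (HT : forall N, T (S N) = T N + w (S N) * e (S N))
    by (intros; unfold T; now rewrite sum_n_S).
  assert (HQ : Rabs ((T (M + k)%nat - w (M + k)%nat * s (M + k)%nat) - (T M - w M * s M))
               <= E * (w M - w (M + k)%nat)).
  { induction k as [|k IH].
    - rewrite Nat.add_0_r, !Rminus_diag, Rabs_R0. lra.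
    - rewrite Nat.add_succ_r. set (m := (M + k)%nat) in *.
      replace (T (S m) - w (S m) * s (S m) - (T M - w M * s M))
        with ((T m - w m * s m - (T M - w M * s M)) + (w m - w (S m)) * s m)
        by (rewrite HT, Hs; ring).
      eapply Rle_trans; [apply Rabs_triang|].
      rewrite Rabs_mult, (Rabs_pos_eq (w m - w (S m))) by (specialize (Hd m); lra).
      assert ((w m - w (S m)) * Rabs (s m) <= (w m - w (S m)) * E).
      { apply Rmult_le_compat_l; [specialize (Hd m); lra|apply HE]. }
      lra. }
  change (Rabs (T (M + k)%nat - T M) <= 2 * E * w M).
  set (m := (M + k)%nat) in *.
  replace (T m - T M) with ((T m - w m * s m - (T M - w M * s M)) + w m * s m - w M * s M)
    by ring.
  unfold Rminus at 1.
  eapply Rle_trans; [apply Rabs_triang|]. rewrite Rabs_Ropp.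
  eapply Rle_trans; [apply Rplus_le_compat_r, Rabs_triang|].
  rewrite !Rabs_mult, !(Rabs_pos_eq (w _)) by auto.
  assert (w m * Rabs (s m) <= w m * E) by (apply Rmult_le_compat_l; auto; apply HE).
  assert (w M * Rabs (s M) <= w M * E) by (apply Rmult_le_compat_l; auto; apply HE).
  lra.
Qed.

Lemma alternating_sine_sums_bounded h z : 0 < h -> 0 <= z <= h ->
  exists E, forall N,
    Rabs (sum_n (fun n => ((-1) ^ S n - 1) * sine_mode h (S n) z) N) <= E.
Proof.
  intros Hh Hz.
  (* The walls are treated apart, since the main argument divides by the first mode at z. *)
  assert (Hend : (forall k, sine_mode h k z = 0) -> exists E, forall N,
    Rabs (sum_n (fun n => ((-1) ^ S n - 1) * sine_mode h (S n) z) N) <= E).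
  { intros Hs. exists 0. intros N.
    rewrite sum_n_zero, Rabs_R0; [lra|]. intros; rewrite Hs; ring. }
  destruct (Req_dec z 0) as [->|H0]; [apply Hend; intros; apply sine_mode_0|].
  destruct (Req_dec z h) as [->|H1]; [apply Hend; intros; now apply sine_mode_h|].
  assert (Hs := sine_mode_1_pos h z ltac:(lra)). clear Hend.
  set (s1 := sine_mode h 1 z) in *.
  (* The product with 2 sin(theta) telescopes in two interleaved chains. *)
  set (b := fun k => ((-1) ^ S k - 1) * cosine_mode h k z
                     + ((-1) ^ k - 1) * cosine_mode h (S k) z).
  assert (Hstep : forall n,
    2 * s1 * (((-1) ^ S n - 1) * sine_mode h (S n) z) = b n - b (S n)).
  { intros n.
    assert (Hp : 2 * s1 * sine_mode h (S n) z
                 = cosine_mode h n z - cosine_mode h (S (S n)) z).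
    { unfold s1, sine_mode, cosine_mode. change (INR 1) with 1. rewrite !S_INR.
      set (x := PI * (INR n + 1) * z / h). set (y := PI * 1 * z / h).
      replace (PI * INR n * z / h) with (x - y) by (unfold x, y, Rdiv; ring).
      replace (PI * (INR n + 1 + 1) * z / h) with (x + y) by (unfold x, y, Rdiv; ring).
      rewrite cos_plus, cos_minus. ring. }
    unfold b. replace (2 * s1 * (((-1) ^ S n - 1) * sine_mode h (S n) z))
      with (((-1) ^ S n - 1) * (2 * s1 * sine_mode h (S n) z)) by ring.
    (* The weights (-1)^k - 1 have period 2 in k, so the terms with the middle cosine cancel between
       b n and b (n + 1). *)
    rewrite Hp. simpl. ring. }
  assert (Hsum : forall N,
    2 * s1 * sum_n (fun n => ((-1) ^ S n - 1) * sine_mode h (S n) z) N = b 0%nat - b (S N)).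
  { induction N as [|N IH]; [rewrite sum_O; apply Hstep|].
    rewrite sum_n_S.
    rewrite Rmult_plus_distr_l, IH, Hstep. ring. }
  assert (Hb : forall k, Rabs (b k) <= 4).
  { intros k. unfold b. eapply Rle_trans; [apply Rabs_triang|]. rewrite !Rabs_mult.
    assert (Hc : forall j, Rabs (cosine_mode h j z) <= 1)
      by (intros; apply Rabs_le, COS_bound).
    assert (Hd : forall j, Rabs ((-1) ^ j - 1) <= 2).
    { intros j. unfold Rminus. eapply Rle_trans; [apply Rabs_triang|].
      rewrite pow_1_abs, Rabs_Ropp, Rabs_R1. lra. }
    assert (Hm : forall i j, Rabs ((-1) ^ i - 1) * Rabs (cosine_mode h j z) <= 2 * 1)
      by (intros; apply Rmult_le_compat; auto; apply Rabs_pos).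
    generalize (Hm (S k) k) (Hm k (S k)). lra. }
  (* A telescoped sum is a difference of two values of b, each at most 4 in absolute value. *)
  exists (8 / (2 * s1)). intros N.
  apply (Rmult_le_reg_l (2 * s1)); [lra|].
  rewrite <- (Rabs_pos_eq (2 * s1)) at 1 by lra. rewrite <- Rabs_mult, Hsum.
  replace (2 * s1 * (8 / (2 * s1))) with 8 by (field; lra).
  unfold Rminus. eapply Rle_trans; [apply Rabs_triang|]. rewrite Rabs_Ropp.
  generalize (Hb 0%nat) (Hb (S N)). lra.
Qed.

Definition kernel_sum (nu h z : R) (N : nat) (s : R) : R :=
  sum_n (fun n => kernel_term nu h z s (S n)) N.

(** Abel's bound with weights 2 / (n pi) exp (...), which decrease in n for every s >= 0 and are at
    most 2 / (n pi), against the bounded sums of alternating sines. The constant depends on z but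
    not on s, and s = 0 is included. *)
Lemma kernel_sum_uniformly_cauchy nu h z : 0 < nu -> 0 < h -> 0 <= z <= h ->
  exists C, forall s, 0 <= s -> forall M k,
    Rabs (kernel_sum nu h z (M + k) s - kernel_sum nu h z M s) <= C / INR (S M).
Proof.
  intros Hnu Hh Hz. assert (HPI := PI_RGT_0).
  destruct (alternating_sine_sums_bounded h z Hh Hz) as [E HE].
  exists (2 * E * (2 / PI)). intros s Hs M k.
  set (w := fun n => 2 / (INR (S n) * PI) * exp (- nu * (PI * INR (S n) / h) ^ 2 * s)).
  assert (HSn : forall n, 0 < INR (S n)) by (intros; apply lt_0_INR; lia).
  assert (Hk : forall N, kernel_sum nu h z N s
    = sum_n (fun n => w n * (((-1) ^ S n - 1) * sine_mode h (S n) z)) N).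
  { intros N. apply sum_n_ext. intros n. unfold kernel_term, w, sine_mode.
    at_R; field. split; [lra|specialize (HSn n); lra]. }
  assert (Hfr : forall n, 0 < 2 / (INR (S n) * PI)).
  { intros n. apply Rdiv_lt_0_compat; [lra|]. now apply Rmult_lt_0_compat. }
  rewrite !Hk. eapply Rle_trans; [apply (abel_tail_bound w _ E)|].
  - intros n. unfold w. apply Rmult_le_pos; [left; apply Hfr|left; apply exp_pos].
  - intros n. unfold w. apply Rmult_le_compat; [left; apply Hfr|left; apply exp_pos| |].
    + apply Rmult_le_compat_l; [lra|]. apply Rinv_le_contravar.
      * now apply Rmult_lt_0_compat.
      * apply Rmult_le_compat_r; [lra|]. apply le_INR. lia.
    + apply exp_le_compat. rewrite !Rmult_assoc, <- !Ropp_mult_distr_l.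
      apply Ropp_le_contravar. apply Rmult_le_compat_l; [lra|].
      apply Rmult_le_compat_r; [easy|]. apply pow_incr. split.
      * left. apply Rdiv_lt_0_compat; [now apply Rmult_lt_0_compat|easy].
      * apply Rmult_le_compat_r; [left; now apply Rinv_0_lt_compat|].
        apply Rmult_le_compat_l; [lra|]. apply le_INR. lia.
  - exact HE.
  - assert (HE0 : 0 <= E) by (eapply Rle_trans; [apply Rabs_pos|apply (HE 0%nat)]).
    replace (2 * E * (2 / PI) / INR (S M)) with (2 * E * (2 / PI * / INR (S M)))
      by (field; assert (HM := HSn M); split; lra).
    apply Rmult_le_compat_l; [lra|]. unfold w.
    replace (2 / PI * / INR (S M)) with (2 / (INR (S M) * PI) * 1)
      by (field; assert (HM := HSn M); split; lra).
    apply Rmult_le_compat_l; [left; apply Hfr|].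
    rewrite <- exp_0. apply exp_le_compat. rewrite !Rmult_assoc, <- Ropp_mult_distr_l.
    assert (0 <= nu * ((PI * INR (S M) / h) ^ 2 * s)); [|lra].
    apply Rmult_le_pos; [lra|]. apply Rmult_le_pos; [apply pow2_ge_0|easy].
Qed.

Lemma INR_archimed_div C eps : 0 < eps -> exists N, forall n, (N <= n)%nat ->
  C / INR (S n) < eps.
Proof.
  intros He. destruct (nfloor_ex (Rabs (C / eps)) (Rabs_pos _)) as [N [_ HN]].
  exists N. intros n Hn.
  assert (Hpos : 0 < INR (S n)) by (apply lt_0_INR; lia).
  apply (Rmult_lt_reg_r (INR (S n))); [easy|]. unfold Rdiv.
  rewrite Rmult_assoc, Rinv_l, Rmult_1_r by lra.
  apply (Rmult_lt_reg_l (/ eps)); [now apply Rinv_0_lt_compat|].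
  rewrite <- Rmult_assoc, Rinv_l, Rmult_1_l by lra.
  apply le_INR in Hn. rewrite S_INR. generalize (Rle_abs (C / eps)).
  unfold Rdiv in *. rewrite (Rmult_comm (/ eps)). lra.
Qed.

Lemma kernel_series_uniform nu h z : 0 < nu -> 0 < h -> 0 <= z <= h ->
  exists C, forall s, 0 <= s ->
    ex_series (fun n => kernel_term nu h z s (S n)) /\
    forall M, Rabs (kernel nu h z s - kernel_sum nu h z M s) <= C / INR (S M).
Proof.
  intros Hnu Hh Hz.
  destruct (kernel_sum_uniformly_cauchy nu h z Hnu Hh Hz) as [C HC].
  exists C. intros s Hs. specialize (HC s Hs).
  assert (Hex : ex_finite_lim_seq (fun N => kernel_sum nu h z N s)).
  { apply ex_lim_seq_cauchy_corr. intros eps.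
    destruct (INR_archimed_div C (eps / 2)) as [N HN]; [apply is_pos_div_2|].
    exists N. intros n m Hn Hm.
    assert (H1 := HC N (n - N)%nat). assert (H2 := HC N (m - N)%nat).
    replace (N + (n - N))%nat with n in H1 by lia.
    replace (N + (m - N))%nat with m in H2 by lia.
    specialize (HN N (le_n N)).
    replace (kernel_sum nu h z n s - kernel_sum nu h z m s)
      with ((kernel_sum nu h z n s - kernel_sum nu h z N s)
            - (kernel_sum nu h z m s - kernel_sum nu h z N s)) by ring.
    eapply Rle_lt_trans; [apply Rabs_triang|]. rewrite Rabs_Ropp. lra. }
  destruct Hex as [l Hl].
  assert (Hser : is_series (fun n => kernel_term nu h z s (S n)) l) by exact Hl.
  split; [now exists l|].
  unfold kernel. rewrite (is_series_unique _ _ Hser). intros M.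
  assert (Hlim : is_lim_seq (fun k => Rabs (kernel_sum nu h z (k + M) s - kernel_sum nu h z M s))
                   (Rabs (l - kernel_sum nu h z M s))).
  { apply (is_lim_seq_abs _ (l - kernel_sum nu h z M s)).
    apply is_lim_seq_minus'; [|apply is_lim_seq_const].
    now apply (is_lim_seq_incr_n (fun N => kernel_sum nu h z N s) M l). }
  refine (lim_seq_le_const _ _ _ _ Hlim).
  intros k. rewrite Nat.add_comm. apply HC.
Qed.

Lemma continuous_bounded (f : R -> R) a b : a <= b -> (forall x, continuous f x) ->
  exists M, forall x, a <= x <= b -> Rabs (f x) <= M.
Proof.
  intros Hab Hf.
  destruct (continuity_ab_maj (fun x => Rabs (f x)) a b Hab) as [m [Hm _]].
  - intros x _. apply continuity_pt_filterlim.
    apply (continuous_comp f Rabs); [apply Hf|]. apply continuous_Rabs.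
  - now exists (Rabs (f m)).
Qed.

Lemma cont_kernel_sum nu h z m s : continuous (kernel_sum nu h z m) s.
Proof.
  induction m as [|m IH].
  - apply (continuous_ext (fun x => kernel_term nu h z x 1)).
    + intros x. unfold kernel_sum. now rewrite sum_O.
    + unfold kernel_term. cont.
  - apply (continuous_ext (fun x => kernel_sum nu h z m x
                                    + kernel_term nu h z x (S (S m)))).
    + intros x. unfold kernel_sum. now rewrite sum_n_S.
    + apply cont_plus; [exact IH|]. unfold kernel_term. cont.
Qed.

Lemma is_RInt_kernel_limit nu h z (p : R -> R) a t : 0 < nu -> 0 < h -> 0 <= z <= h ->
  a <= t -> (forall s, continuous p s) ->
  exists I, is_RInt (fun tau => kernel nu h z (t - tau) * p tau) a t I /\
    is_lim_seq (fun N => RInt (fun tau => kernel_sum nu h z N (t - tau) * p tau) a t) I.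
Proof.
  intros Hnu Hh Hz Hat Hp.
  destruct (kernel_series_uniform nu h z Hnu Hh Hz) as [C HC].
  destruct (continuous_bounded p a t Hat Hp) as [B HB].
  assert (Hcl : forall s, continuous (clamp a t) s) by apply cont_clamp.
  assert (Hks : forall N s, continuous (kernel_sum nu h z N) s)
    by apply cont_kernel_sum.
  (* This exchange of limit and integral wants convergence uniform on the whole line. Clamping tau
     to [a, t] keeps the elapsed time nonnegative, where the uniform bound holds, and changes
     nothing on the interval of integration. *)
  destruct (filterlim_RInt
    (fun N tau => kernel_sum nu h z N (t - clamp a t tau) * p (clamp a t tau)) a t
    eventually _ (fun tau => kernel nu h z (t - clamp a t tau) * p (clamp a t tau))
    (fun N => RInt (fun tau => kernel_sum nu h z N (t - tau) * p tau) a t))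
    as [I [HI1 HI2]].
  - intros N. apply (is_RInt_ext (fun tau => kernel_sum nu h z N (t - tau) * p tau)).
    + rewrite Rmin_left, Rmax_right by easy. intros tau Htau.
      now rewrite clamp_id by lra.
    + apply (RInt_correct (fun tau => kernel_sum nu h z N (t - tau) * p tau)).
      apply cont_ex_RInt. intros s. specialize (Hks N). cont.
  - apply filterlim_locally. intros eps.
    assert (HB1 : 0 < Rabs B + 1) by (generalize (Rabs_pos B); lra).
    destruct (INR_archimed_div C (eps / (Rabs B + 1))) as [N HN].
    { apply Rdiv_lt_0_compat; [apply eps|easy]. }
    exists N. intros n Hn tau.
    assert (Htau := clamp_in a t tau Hat).
    destruct (HC (t - clamp a t tau)) as [_ HC']; [lra|].
    specialize (HC' n). specialize (HN n Hn). specialize (HB _ Htau).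
    change (Rabs (kernel_sum nu h z n (t - clamp a t tau) * p (clamp a t tau)
      - kernel nu h z (t - clamp a t tau) * p (clamp a t tau)) < eps).
    rewrite <- Rmult_minus_distr_r, Rabs_mult, Rabs_minus_sym.
    apply Rle_lt_trans with (C / INR (S n) * (Rabs B + 1)).
    + apply Rmult_le_compat; try apply Rabs_pos; [easy|].
      generalize (Rle_abs B). lra.
    + apply (Rmult_lt_compat_r (Rabs B + 1)) in HN; [|easy].
      replace (eps / (Rabs B + 1) * (Rabs B + 1)) with (pos eps) in HN by (field; lra).
      exact HN.
  - exists I. split; [|exact HI1].
    apply (is_RInt_ext (fun tau => kernel nu h z (t - clamp a t tau) * p (clamp a t tau)));
      [|exact HI2].
    rewrite Rmin_left, Rmax_right by easy. intros tau Htau.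
    now rewrite clamp_id by lra.
Qed.

Lemma geometric_partial_le (q : R) N : 0 <= q -> (1 - q) * sum_n (fun n => q ^ S n) N <= q.
Proof.
  intros Hq.
  assert (H : (1 - q) * sum_n (fun n => q ^ S n) N = q - q ^ S (S N)).
  { induction N as [|N IH]; [rewrite sum_O; simpl; ring|].
    rewrite sum_n_S. rewrite Rmult_plus_distr_l, IH. simpl. ring. }
  rewrite H. generalize (pow_le q (S (S N)) Hq). lra.
Qed.

(** With kap the decay rate of the first mode and q = exp (- kap d), the inequality k^2 >= k
    dominates the decay factors by the geometric series of q. Its sum is at most 1 / (kap d) because
    exp x >= 1 + x. *)
Lemma heat_modes_bound nu h z (c : nat -> R) B d : 0 < nu -> 0 < h -> 0 < d -> 0 <= B ->
  (forall k, Rabs (c k) <= B) ->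
  forall N, Rabs (sum_n (fun n => 2 / h * (exp (- (nu * wavenumber h (S n) ^ 2) * d) * c (S n))
                                   * sine_mode h (S n) z) N)
  <= 2 * B / h / (nu * wavenumber h 1 ^ 2 * d).
Proof.
  intros Hnu Hh Hd HB Hc N.
  set (kap := nu * wavenumber h 1 ^ 2).
  assert (Hkap : 0 < kap).
  { apply Rmult_lt_0_compat; [easy|]. apply pow_lt. apply wavenumber_pos; [easy|lia]. }
  set (q := exp (- kap * d)).
  assert (Hkd : 0 < kap * d) by now apply Rmult_lt_0_compat.
  assert (Hq : 0 < q) by apply exp_pos.
  assert (Hterm : forall n,
    Rabs (2 / h * (exp (- (nu * wavenumber h (S n) ^ 2) * d) * c (S n)) * sine_mode h (S n) z)
    <= 2 * B / h * q ^ S n).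
  { intros n. rewrite !Rabs_mult.
    rewrite (Rabs_pos_eq (2 / h)) by (left; apply Rdiv_lt_0_compat; lra).
    rewrite (Rabs_pos_eq (exp _)) by (left; apply exp_pos).
    assert (Hs : Rabs (sine_mode h (S n) z) <= 1) by apply Rabs_le, SIN_bound.
    assert (He : exp (- (nu * wavenumber h (S n) ^ 2) * d) <= q ^ S n).
    { unfold q. rewrite <- exp_INR_mult. apply exp_le_compat.
      replace (wavenumber h (S n)) with (INR (S n) * wavenumber h 1)
        by (unfold wavenumber; simpl INR at 2; field; lra).
      replace (- (nu * (INR (S n) * wavenumber h 1) ^ 2) * d)
        with (INR (S n) * (- kap * d) * INR (S n)) by (unfold kap; ring).
      assert (1 <= INR (S n)) by (rewrite S_INR; generalize (pos_INR n); lra).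
      assert (0 <= INR (S n) * (kap * d)) by (apply Rmult_le_pos; lra).
      nra. }
    specialize (Hc (S n)).
    replace (2 * B / h * q ^ S n) with (2 / h * (q ^ S n * B) * 1) by (field; lra).
    assert (0 < 2 / h) by (apply Rdiv_lt_0_compat; lra).
    apply Rmult_le_compat; [|apply Rabs_pos| |easy].
    - apply Rmult_le_pos; [lra|].
      apply Rmult_le_pos; [left; apply exp_pos|apply Rabs_pos].
    - apply Rmult_le_compat_l; [lra|].
      apply Rmult_le_compat; [left; apply exp_pos|apply Rabs_pos|easy|easy]. }
  assert (Hsum : Rabs (sum_n (fun n =>
      2 / h * (exp (- (nu * wavenumber h (S n) ^ 2) * d) * c (S n)) * sine_mode h (S n) z) N)
    <= 2 * B / h * sum_n (fun n => q ^ S n) N).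
  { induction N as [|N IH]; [rewrite !sum_O; apply Hterm|].
    rewrite !sum_n_S.
    eapply Rle_trans; [apply Rabs_triang|].
    rewrite Rmult_plus_distr_l. apply Rplus_le_compat; [exact IH|apply Hterm]. }
  eapply Rle_trans; [exact Hsum|]. unfold Rdiv at 3.
  apply Rmult_le_compat_l.
  { unfold Rdiv. apply Rmult_le_pos; [lra|]. left. now apply Rinv_0_lt_compat. }
  assert (Hg := geometric_partial_le q N (Rlt_le _ _ Hq)).
  set (S0 := sum_n (fun n => q ^ S n) N : R) in *. change ((1 - q) * S0 <= q) in Hg.
  change (S0 <= / (kap * d)).
  assert (Hqk : q * (1 + kap * d) <= 1).
  { apply Rle_trans with (q * exp (kap * d)).
    - apply Rmult_le_compat_l; [lra|]. left. apply exp_ineq1. now apply Rgt_not_eq.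
    - unfold q. rewrite <- exp_plus.
      replace (- kap * d + kap * d) with 0 by ring. rewrite exp_0. lra. }
  clear - Hkd Hq Hg Hqk. clearbody S0 q. revert Hkd Hqk. generalize (kap * d).
  intros x Hx Hqx.
  apply (Rmult_le_reg_l x); [easy|]. rewrite Rinv_r by lra.
  apply (Rmult_le_reg_l q); [easy|].
  destruct (Rle_lt_dec S0 0) as [H0|H0].
  - assert (x * S0 <= x * 0) by (apply Rmult_le_compat_l; lra).
    apply Rmult_le_compat_l; lra.
  (* From q (1 + x) <= 1 one gets q x <= 1 - q; multiplying by S0 meets the geometric bound (1 - q)
     S0 <= q. *)
  - assert (q * x * S0 <= (1 - q) * S0) by (apply Rmult_le_compat_r; lra). lra.
Qed.

(** The kernel is minus the heat semigroup applied to the constant 1; integrating it against p1 is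
    therefore the response to the forcing - p1. *)
Lemma kernel_term_mode nu h z s k : 0 < h -> (0 < k)%nat ->
  kernel_term nu h z s k
  = - (2 / h * RInt (sine_mode h k) 0 h)
    * exp (- (nu * wavenumber h k ^ 2) * s) * sine_mode h k z.
Proof.
  intros Hh Hk. rewrite sine_mode_mean by easy. unfold kernel_term, wavenumber, sine_mode.
  replace (- (nu * (PI * INR k / h) ^ 2) * s) with (- nu * (PI * INR k / h) ^ 2 * s) by ring.
  apply lt_0_INR in Hk. assert (HPI := PI_RGT_0). field. repeat split; lra.
Qed.

Lemma damped_mode_duhamel (mu m : R) (c p : R -> R) a t : a <= t ->
  (forall s, continuous p s) ->
  (forall s, is_derive c s (- mu * c s - m * p s)) ->
  RInt (fun tau => - m * exp (- mu * (t - tau)) * p tau) a t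
  = c t - exp (- mu * (t - a)) * c a.
Proof.
  intros Hat Hp Hc.
  assert (Cc : forall s, continuous c s)
    by (intros s; apply cont_of_derivable; eexists; apply Hc).
  rewrite (RInt_of_derive (fun tau => exp (- mu * (t - tau)) * c tau)).
  - rewrite Rminus_diag, Rmult_0_r, exp_0. at_R; ring.
  - easy.
  - intros; cont.
  - intros tau _.
    assert (E : Derive c tau = - mu * c tau - m * p tau) by apply is_derive_unique, Hc.
    auto_derive; [known Hc|]. change (fun x => c x) with c. rewrite E.
    unfold Rminus. ring.
  - intros; cont.
Qed.

(** On a finite interval [a, t] the error v t - I is the limit of [R0], the part of the data at time
    a that has survived until t. Its bound goes to 0 as a goes to minus infinity, which is the
    convergence of the improper integral. *)
Lemma duhamel_sine_series nu h z (p : R -> R) (c : nat -> R -> R) (v : R -> R) (B : R) t :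
  0 < nu -> 0 < h -> 0 <= z <= h -> 0 <= B ->
  (forall s, continuous p s) ->
  (forall k s, is_derive (c k) s (- (nu * wavenumber h k ^ 2) * c k s
                                  - RInt (sine_mode h k) 0 h * p s)) ->
  (forall k s, Rabs (c k s) <= B) ->
  (forall s, is_lim_seq (sum_n (fun n => 2 / h * c (S n) s * sine_mode h (S n) z)) (v s)) ->
  is_RInt_gen (fun tau => kernel nu h z (t - tau) * p tau)
    (Rbar_locally m_infty) (at_point t) (v t).
Proof.
  intros Hnu Hh Hz HB Hp Hc HcB Hv.
  set (kap := nu * wavenumber h 1 ^ 2).
  assert (Hkap : 0 < kap).
  { apply Rmult_lt_0_compat; [easy|]. apply pow_lt. apply wavenumber_pos; [easy|lia]. }
  assert (Hmain : forall a, a < t -> exists I,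
    is_RInt (fun tau => kernel nu h z (t - tau) * p tau) a t I /\
    Rabs (v t - I) <= 2 * B / h / (kap * (t - a))).
  { intros a Ha.
    destruct (is_RInt_kernel_limit nu h z p a t Hnu Hh Hz (Rlt_le _ _ Ha) Hp)
      as [I [HI HL]].
    exists I. split; [exact HI|].
    set (R0 := (fun N => sum_n (fun n => 2 / h
      * (exp (- (nu * wavenumber h (S n) ^ 2) * (t - a)) * c (S n) a)
      * sine_mode h (S n) z) N) : nat -> R).
    assert (Hterm : forall n, RInt (fun tau => kernel_term nu h z (t - tau) (S n) * p tau) a t
      = 2 / h * sine_mode h (S n) z
        * (c (S n) t - exp (- (nu * wavenumber h (S n) ^ 2) * (t - a)) * c (S n) a)).
    { intros n.
      rewrite <- (damped_mode_duhamel (nu * wavenumber h (S n) ^ 2)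
                   (RInt (sine_mode h (S n)) 0 h) (c (S n)) p) by (auto; lra).
      rewrite <- RInt_mult_l by (apply cont_ex_RInt; intros; cont).
      apply RInt_ext. intros tau _. rewrite kernel_term_mode by (auto; lia).
      at_R; ring. }
    assert (Hsum : forall N,
      RInt (fun tau => kernel_sum nu h z N (t - tau) * p tau) a t
      = sum_n (fun n => 2 / h * c (S n) t * sine_mode h (S n) z) N - R0 N).
    { induction N as [|N IH].
      - unfold R0. rewrite !sum_O.
        rewrite (RInt_ext _ (fun tau => kernel_term nu h z (t - tau) 1 * p tau))
          by (intros; unfold kernel_sum; now rewrite sum_O).
        rewrite Hterm. at_R; ring.
      - assert (HR0 : R0 (S N) = R0 N + 2 / h
          * (exp (- (nu * wavenumber h (S (S N)) ^ 2) * (t - a)) * c (S (S N)) a)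
          * sine_mode h (S (S N)) z) by (unfold R0; now rewrite sum_n_S).
        rewrite HR0, sum_n_S.
        rewrite (RInt_ext _ (fun tau => 1 * (kernel_sum nu h z N (t - tau) * p tau)
                  + 1 * (kernel_term nu h z (t - tau) (S (S N)) * p tau))).
        + assert (Hks := cont_kernel_sum nu h z N).
          rewrite RInt_lin, IH, Hterm.
          * at_R; ring.
          * apply cont_ex_RInt; intros; cont.
          * apply cont_ex_RInt; intros; unfold kernel_term; cont.
        + intros. unfold kernel_sum. rewrite sum_n_S. simpl. at_R; ring. }
    assert (HR : is_lim_seq R0 (v t - I)).
    { apply (is_lim_seq_ext (fun N =>
        sum_n (fun n => 2 / h * c (S n) t * sine_mode h (S n) z) N
        - RInt (fun tau => kernel_sum nu h z N (t - tau) * p tau) a t)).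
      - intros N. rewrite Hsum. at_R; ring.
      - apply is_lim_seq_minus'; [apply Hv|exact HL]. }
    apply (is_lim_seq_abs _ (v t - I)) in HR.
    refine (lim_seq_le_const _ _ _ _ HR).
    intros N. apply (heat_modes_bound nu h z (fun k => c k a) B (t - a)); auto. lra. }
  intros P [eps HP].
  (* Chosen so that a < a0 makes the error bound smaller than eps; the 1 guarantees a < t even when
     B = 0. *)
  set (a0 := t - (2 * B / h / kap / eps + 1)).
  assert (Hnn : 0 <= 2 * B / h / kap / eps).
  { unfold Rdiv. repeat apply Rmult_le_pos; try lra;
      left; apply Rinv_0_lt_compat; auto. apply eps. }
  apply (Filter_prod _ _ _ (fun a => a < a0) (fun b => b = t)).
  - now exists a0.
  - easy.
  - intros a b Ha ->. unfold a0 in Ha. destruct (Hmain a) as [I [HI HIb]]; [lra|].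
    exists I. split; [exact HI|]. apply HP. change (Rabs (I - v t) < eps).
    rewrite Rabs_minus_sym. eapply Rle_lt_trans; [exact HIb|].
    assert (Heps := cond_pos eps).
    assert (Hd : 2 * B / h / kap / eps < t - a) by lra.
    apply (Rmult_lt_reg_r (t - a)); [lra|].
    apply (Rmult_lt_compat_l eps) in Hd; [|easy].
    replace (eps * (2 * B / h / kap / eps)) with (2 * B / h / kap) in Hd
      by (field; repeat split; lra).
    replace (2 * B / h / (kap * (t - a)) * (t - a)) with (2 * B / h / kap)
      by (field; repeat split; lra).
    exact Hd.
Qed.

(** * Shear flows in a channel *)

(* A velocity profile [u x t z] in the transverse coordinates x = x2 and
   z = x3; equations in z are only required on the section [0, h]. *)
Record shear_flow (nu h L : R) (p : R -> R)
    (u ut ux uxx uz uzz : R -> R -> R -> R) : Prop := {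
  cont_u : cont3 u;
  cont_ut : cont3 ut;
  cont_ux : cont3 ux;
  cont_uxx : cont3 uxx;
  cont_uz : cont3 uz;
  cont_uzz : cont3 uzz;
  cont_p : forall t, continuous p t;
  derive_t : forall x t z, is_derive (fun s => u x s z) t (ut x t z);
  derive_x : forall x t z, is_derive (fun y => u y t z) x (ux x t z);
  derive_xx : forall x t z, is_derive (fun y => ux y t z) x (uxx x t z);
  derive_z : forall x t z, 0 < z < h -> is_derive (u x t) z (uz x t z);
  derive_zz : forall x t z, 0 < z < h -> is_derive (uz x t) z (uzz x t z);
  momentum : forall x t z, 0 <= z <= h ->
    ut x t z = nu * (uxx x t z + uzz x t z) - p t;
  bottom : forall x t, u x t 0 = 0;
  top : forall x t, u x t h = 0;
  periodic : forall x t z, 0 <= z <= h -> u (x + L) t z = u x t z;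
  energy_bounded : exists M, forall t,
    RInt (fun x => RInt (fun z => u x t z * u x t z) 0 h) 0 L <= M
}.

Lemma cont2_sine_coef h k f : 0 < h -> cont3 f ->
  cont2 (fun x t => sine_coef h (f x t) k).
Proof.
  intros Hh Hf q. unfold sine_coef.
  apply (cont_RInt_param (fun (q : R * R) z => f (fst q) (snd q) z * sine_mode h k z));
    [lra|]. intros y z. cont.
Qed.

Lemma is_derive_sine_coef h k (f df : R -> R -> R) s :
  (forall s z, is_derive (fun s => f s z) s (df s z)) -> cont2 f -> cont2 df ->
  is_derive (fun s => sine_coef h (f s) k) s (sine_coef h (df s) k).
Proof.
  intros Hd Hf Hdf.
  apply (is_derive_RInt_parameter (fun s z => f s z * sine_mode h k z)
           (fun s z => df s z * sine_mode h k z)); [|intros; cont|intros; cont].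
  intros r z. assert (E : Derive (fun s => f s z) r = df r z) by apply is_derive_unique, Hd.
  auto_derive; [known Hd|]. rewrite E. ring.
Qed.

Lemma sine_coef_ext h f g k : 0 < h -> (forall z, 0 <= z <= h -> f z = g z) ->
  sine_coef h f k = sine_coef h g k.
Proof.
  intros Hh H. apply RInt_ext. intros z Hz. rewrite Rmin_left, Rmax_right in Hz by lra.
  now rewrite H by lra.
Qed.

(** Green's identity. Of the boundary terms, the one with f' is killed by the mode and the one with
    the cosine by f = 0 at the walls. *)
Lemma sine_coef_second_derivative h k (f f' f'' : R -> R) : 0 < h ->
  (forall z, continuous f z) -> (forall z, continuous f' z) ->
  (forall z, continuous f'' z) ->
  (forall z, 0 < z < h -> is_derive f z (f' z)) ->
  (forall z, 0 < z < h -> is_derive f' z (f'' z)) ->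
  f 0 = 0 -> f h = 0 ->
  sine_coef h f'' k = - wavenumber h k ^ 2 * sine_coef h f k.
Proof.
  intros Hh C0 C1 C2 D1 D2 H0 H1. set (w := wavenumber h k).
  enough (E : 1 * sine_coef h f'' k + w ^ 2 * sine_coef h f k = 0) by lra.
  unfold sine_coef. rewrite <- RInt_lin by integrable.
  rewrite (RInt_of_derive (fun z => f' z * sine_mode h k z - f z * (w * cosine_mode h k z))).
  - rewrite H0, H1, sine_mode_0, sine_mode_h by easy. at_R; ring.
  - lra.
  - intros; cont.
  - intros z Hz.
    assert (E1 : Derive f z = f' z) by now apply is_derive_unique, D1.
    assert (E2 : Derive f' z = f'' z) by now apply is_derive_unique, D2.
    auto_derive.
    + repeat split; try ex_derive_mode; eexists; [now apply D2|now apply D1].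
    + change (fun x => f x) with f. change (fun x => f' x) with f'.
      rewrite E1, E2, Derive_sine_mode, Derive_cosine_mode. fold w. ring.
  - intros; cont.
Qed.

Lemma sine_coef_determines h (f g : R -> R) z : 0 < h -> 0 <= z <= h ->
  (forall y, continuous f y) -> (forall y, continuous g y) ->
  f 0 = 0 -> f h = 0 -> g 0 = 0 -> g h = 0 ->
  (0 < z < h -> ex_derive f z) -> (0 < z < h -> ex_derive g z) ->
  (forall k, sine_coef h f k = sine_coef h g k) -> f z = g z.
Proof.
  intros Hh Hz Cf Cg f0 fh g0 gh Df Dg E.
  assert (H1 := sine_series h f z Hh Hz Cf f0 fh Df).
  assert (H2 := sine_series h g z Hh Hz Cg g0 gh Dg).
  apply (is_lim_seq_ext _
    (sum_n (fun n => 2 / h * sine_coef h g (S n) * sine_mode h (S n) z))) in H1.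
  - apply is_lim_seq_unique in H1, H2. rewrite H1 in H2. now injection H2.
  - intros N. apply sum_n_ext. intros n. now rewrite E.
Qed.

Section ShearFlow.

Context {nu h L : R} {p : R -> R} {u ut ux uxx uz uzz : R -> R -> R -> R}.
Context (nu_pos : 0 < nu) (h_pos : 0 < h) (L_pos : 0 < L).
Context (flow : shear_flow nu h L p u ut ux uxx uz uzz).

Lemma sine_coef_momentum k x t :
  sine_coef h (ut x t) k
  = nu * sine_coef h (uxx x t) k - nu * wavenumber h k ^ 2 * sine_coef h (u x t) k
    - RInt (sine_mode h k) 0 h * p t.
Proof.
  destruct flow as [Cu Cut Cux Cuxx Cuz Cuzz Cp Dt Dx Dxx Dz Dzz Eq Bot Top Per En].
  rewrite (sine_coef_ext h _ (fun z => 1 * (nu * uxx x t z + nu * uzz x t z) + (- p t) * 1))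
    by (auto; intros; rewrite Eq by easy; ring).
  rewrite sine_coef_lin by (intros; cont).
  rewrite sine_coef_lin by (intros; cont).
  rewrite (sine_coef_second_derivative h k (u x t) (uz x t) (uzz x t)); auto;
    try solve [intros; cont].
  replace (sine_coef h (fun _ => 1) k) with (RInt (sine_mode h k) 0 h); [ring|].
  apply RInt_ext. intros. at_R; ring.
Qed.

Lemma cont_profile_energy x t :
  continuous (fun x => RInt (fun z => u x t z * u x t z) 0 h : R) x.
Proof.
  assert (Cu := cont_u _ _ _ _ _ _ _ _ _ _ flow).
  apply (cont_RInt_param (fun x z => u x t z * u x t z)); [lra|].
  intros; cont.
Qed.

Lemma sine_coef_independent k x t : (0 < k)%nat ->
  sine_coef h (u x t) k = sine_coef h (u 0 t) k.
Proof.
  intros Hk.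
  destruct flow as [Cu Cut Cux Cuxx Cuz Cuzz Cp Dt Dx Dxx Dz Dzz Eq Bot Top Per [M HM]].
  apply (ancient_periodic_constant nu (wavenumber h k ^ 2) L
    (fun t => RInt (sine_mode h k) 0 h * p t)
    (fun x t => sine_coef h (u x t) k) (fun x t => sine_coef h (ut x t) k)
    (fun x t => sine_coef h (ux x t) k) (fun x t => sine_coef h (uxx x t) k)); auto.
  - apply pow_lt. now apply wavenumber_pos.
  - now apply cont2_sine_coef.
  - now apply cont2_sine_coef.
  - now apply cont2_sine_coef.
  - now apply cont2_sine_coef.
  - intros x' t'. apply is_derive_sine_coef; [apply Dt| |]; intros q; cont.
  - intros x' t'.
    apply (is_derive_sine_coef h k (fun y => u y t') (fun y => ux y t'));
      [intros; apply Dx| |]; intros q; cont.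
  - intros x' t'.
    apply (is_derive_sine_coef h k (fun y => ux y t') (fun y => uxx y t'));
      [intros; apply Dxx| |]; intros q; cont.
  - intros x' t'. apply sine_coef_momentum.
  - intros x' t'. apply sine_coef_ext; auto.
  (* Each squared coefficient is at most h / 2 times the energy of its section; integrating over x2
     brings in the total energy bound M. *)
  - exists (h / 2 * M). intros t'.
    apply Rle_trans with (h / 2 * RInt (fun x => RInt (fun z => u x t' z * u x t' z) 0 h) 0 L);
      [|apply Rmult_le_compat_l; [lra|apply HM]].
    assert (CE := fun x => cont_profile_energy x t').
    rewrite <- RInt_mult_l by (apply cont_ex_RInt; exact CE).
    apply RInt_le; [lra| | |].
    + assert (Cc := cont2_sine_coef h k u h_pos Cu). apply cont_ex_RInt. intros y.
      assert (continuous (fun y => sine_coef h (u y t') k) y).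
      { apply (cont2_comp (fun x t => sine_coef h (u x t) k) (fun y => y) (fun _ => t'));
          [exact Cc|cont|cont]. }
      now apply cont_mult.
    + apply cont_ex_RInt. intros y. apply cont_mult; [cont|apply CE].
    + intros y _.
      assert (H := sine_coef_sqr_le h (u y t') k h_pos).
      replace (sine_coef h (u y t') k * sine_coef h (u y t') k)
        with (sine_coef h (u y t') k ^ 2) by ring.
      apply H. intros; cont.
Qed.

Lemma shear_flow_independent x t z : 0 <= z <= h -> u x t z = u 0 t z.
Proof.
  intros Hz.
  destruct flow as [Cu Cut Cux Cuxx Cuz Cuzz Cp Dt Dx Dxx Dz Dzz Eq Bot Top Per En].
  apply (sine_coef_determines h); auto; try solve [intros; cont].
  - intros Hz'. eexists. now apply Dz.
  - intros Hz'. eexists. now apply Dz.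
  (* Mode 0 stays outside the decay argument, whose rate would be 0 there; its coefficients vanish
     trivially. *)
  - intros [|k]; [|apply sine_coef_independent; lia].
    apply RInt_ext. intros y _. rewrite sine_mode_O. at_R; ring.
Qed.

Lemma uxx_zero x t z : 0 <= z <= h -> uxx x t z = 0.
Proof.
  intros Hz.
  destruct flow as [Cu Cut Cux Cuxx Cuz Cuzz Cp Dt Dx Dxx Dz Dzz Eq Bot Top Per En].
  assert (H : forall y, ux y t z = 0).
  { intros y. rewrite <- (is_derive_unique _ _ _ (Dx y t z)).
    rewrite (Derive_ext _ (fun _ => u 0 t z)); [apply Derive_const|].
    intros; now apply shear_flow_independent. }
  rewrite <- (is_derive_unique _ _ _ (Dxx x t z)).
  rewrite (Derive_ext _ (fun _ => 0)); [apply Derive_const|easy].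
Qed.

Lemma section_energy_bound : exists B, 0 <= B /\
  forall k t, Rabs (sine_coef h (u 0 t) k) <= B.
Proof.
  destruct (energy_bounded _ _ _ _ _ _ _ _ _ _ flow) as [M HM].
  assert (Cu := cont_u _ _ _ _ _ _ _ _ _ _ flow).
  (* By independence of x2 the energy of each section is at most M / L. The 1 replaces a square
     root: a^2 <= K implies a <= K + 1. *)
  exists (h / 2 * (M / L) + 1).
  assert (HE : forall t, RInt (fun z => u 0 t z * u 0 t z) 0 h <= M / L).
  { intros t. specialize (HM t).
    rewrite (RInt_ext _ (fun _ => RInt (fun z => u 0 t z * u 0 t z) 0 h)), RInt_cst in HM.
    - apply (Rmult_le_reg_l L); [easy|]. replace (L * (M / L)) with M by (field; lra).
      replace (L - 0) with L in HM by ring. exact HM.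
    - intros x _. apply RInt_ext. intros z Hz. rewrite Rmin_left, Rmax_right in Hz by lra.
      now rewrite shear_flow_independent by lra. }
  assert (Hsq : forall k t, sine_coef h (u 0 t) k ^ 2 <= h / 2 * (M / L)).
  { intros k t. eapply Rle_trans; [apply sine_coef_sqr_le; [easy|intros; cont]|].
    apply Rmult_le_compat_l; [lra|apply HE]. }
  assert (H0 : 0 <= h / 2 * (M / L))
    by (eapply Rle_trans; [apply pow2_ge_0|apply (Hsq 0%nat 0)]).
  split; [lra|]. intros k t. specialize (Hsq k t). rewrite <- pow2_abs in Hsq.
  generalize (Rabs_pos (sine_coef h (u 0 t) k)). nra.
Qed.

Lemma shear_flow_duhamel z t : 0 <= z <= h ->
  is_RInt_gen (fun tau => kernel nu h z (t - tau) * p tau)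
    (Rbar_locally m_infty) (at_point t) (u 0 t z).
Proof.
  intros Hz. destruct section_energy_bound as [B [HB0 HB]].
  assert (Hxx := uxx_zero). assert (Hmom := sine_coef_momentum).
  destruct flow as [Cu Cut Cux Cuxx Cuz Cuzz Cp Dt Dx Dxx Dz Dzz Eq Bot Top Per En].
  apply (duhamel_sine_series nu h z p (fun k s => sine_coef h (u 0 s) k)
           (fun s => u 0 s z) B); auto.
  - intros k s.
    replace (- (nu * wavenumber h k ^ 2) * sine_coef h (u 0 s) k
             - RInt (sine_mode h k) 0 h * p s) with (sine_coef h (ut 0 s) k).
    + apply is_derive_sine_coef; [apply Dt| |]; intros q; cont.
    + rewrite Hmom. replace (sine_coef h (uxx 0 s) k) with 0; [ring|].
      rewrite (sine_coef_ext h _ (fun _ => 0)) by auto.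
      unfold sine_coef. rewrite (RInt_ext _ (fun _ => 0)), RInt_cst; [at_R; ring|].
      intros; at_R; ring.
  - intros s. apply sine_series; auto; try solve [intros; cont].
    intros Hz'. eexists. now apply Dz.
Qed.

End ShearFlow.

(** * Reduction of the Navier-Stokes system *)

Lemma is_pd_eps D c f p l :
  is_pd D c f p l <->
  forall eps : posreal, exists d : posreal, forall y,
    Rabs (y - get c p) < d -> y <> get c p -> D (upd c p y) ->
    Rabs ((f (upd c p y) - f p) / (y - get c p) - l) < eps.
Proof.
  unfold is_pd. split.
  - intros H eps. destruct (proj1 (filterlim_locally _ l) H eps) as [d Hd].
    exists d. intros y Hy Hne HD. exact (Hd y Hy Hne HD).
  - intros H. apply filterlim_locally. intros eps. destruct (H eps) as [d Hd].
    exists d. intros y Hy Hne HD. exact (Hd y Hy Hne HD).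
Qed.

Lemma upd_get c p : upd c p (get c p) = p.
Proof. destruct p as [[[x1 x2] x3] t]. now destruct c as [[]|]. Qed.

Lemma get_upd c p y : get c (upd c p y) = y.
Proof. destruct p as [[[x1 x2] x3] t]. now destruct c as [[]|]. Qed.

(** Step towards the farther wall by at most h / 2. This is what makes limits within the channel
    unique, so that [pd] is determined wherever a derivative exists, also at the walls. *)
Lemma channel_no_isolated_point h c p (d : posreal) : 0 < h -> channel h p ->
  exists y, Rabs (y - get c p) < d /\ y <> get c p /\ channel h (upd c p y).
Proof.
  intros Hh Hp. assert (Hd := cond_pos d).
  set (e := Rmin (d / 2) (h / 2)).
  assert (He1 := Rmin_l (d / 2) (h / 2)). assert (He2 := Rmin_r (d / 2) (h / 2)).
  assert (He : 0 < e) by (apply Rmin_pos; lra). fold e in He1, He2.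
  assert (Hup : Rabs (get c p + e - get c p) < d).
  { replace (get c p + e - get c p) with e by ring. rewrite Rabs_pos_eq; lra. }
  destruct (Rle_lt_dec (get e3 p) (h / 2)) as [H|H].
  - exists (get c p + e). split; [easy|]. split; [lra|].
    destruct p as [[[x1 x2] x3] t]. unfold channel in *.
    destruct c as [[]|]; simpl in *; lra.
  - exists (get c p - e). split.
    + replace (get c p - e - get c p) with (- e) by ring.
      rewrite Rabs_Ropp, Rabs_pos_eq; lra.
    + split; [lra|]. destruct p as [[[x1 x2] x3] t]. unfold channel in *.
      destruct c as [[]|]; simpl in *; lra.
Qed.

Lemma is_pd_unique h c f p l1 l2 : 0 < h -> channel h p ->
  is_pd (channel h) c f p l1 -> is_pd (channel h) c f p l2 -> l1 = l2.
Proof.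
  intros Hh Hp H1 H2. apply Rminus_diag_uniq. apply Rabs_eq_0.
  apply Rle_antisym; [|apply Rabs_pos]. apply Rnot_lt_le. intros Hpos.
  assert (He : 0 < Rabs (l1 - l2) / 2) by lra.
  destruct (proj1 (is_pd_eps _ _ _ _ _) H1 (mkposreal _ He)) as [d1 Hd1].
  destruct (proj1 (is_pd_eps _ _ _ _ _) H2 (mkposreal _ He)) as [d2 Hd2].
  assert (Hd : 0 < Rmin d1 d2) by (apply Rmin_pos; apply cond_pos).
  destruct (channel_no_isolated_point h c p (mkposreal _ Hd) Hh Hp) as [y [Hy [Hne HD]]].
  simpl in Hy. assert (Hm1 := Rmin_l d1 d2). assert (Hm2 := Rmin_r d1 d2).
  specialize (Hd1 y ltac:(lra) Hne HD). specialize (Hd2 y ltac:(lra) Hne HD).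
  simpl in Hd1, Hd2. set (q := (f (upd c p y) - f p) / (y - get c p)) in *.
  replace (l1 - l2) with ((q - l2) + - (q - l1)) in Hpos, Hd1, Hd2 by ring.
  assert (Ht := Rabs_triang (q - l2) (- (q - l1))). rewrite Rabs_Ropp in Ht.
  lra.
Qed.

Lemma pd_correct h c f p : 0 < h -> channel h p -> ex_pd (channel h) c f p ->
  is_pd (channel h) c f p (pd (channel h) c f p).
Proof.
  intros Hh Hp [l Hl].
  apply (iota_correct (V := R_CompleteNormedModule) (is_pd (channel h) c f p)).
  exists l. split; [exact Hl|]. intros l' Hl'. now apply (is_pd_unique h c f p).
Qed.

Lemma pd_unique h c f p l : 0 < h -> channel h p -> is_pd (channel h) c f p l ->
  pd (channel h) c f p = l.
Proof.
  intros Hh Hp Hl. apply (is_pd_unique h c f p); auto.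
  apply pd_correct; auto. now exists l.
Qed.

Lemma pd_zero h c f p : 0 < h -> channel h p -> (forall q, channel h q -> f q = 0) ->
  pd (channel h) c f p = 0.
Proof.
  intros Hh Hp Hf. apply pd_unique; auto. apply is_pd_eps. intros eps.
  exists eps. intros y _ _ HD. rewrite !Hf by easy.
  replace ((0 - 0) / (y - get c p) - 0) with 0 by (unfold Rdiv; ring).
  rewrite Rabs_R0. apply cond_pos.
Qed.

Lemma is_pd_derive h c f p l :
  channel h p -> locally (get c p) (fun y => channel h (upd c p y)) ->
  is_pd (channel h) c f p l -> is_derive (fun y => f (upd c p y)) (get c p) l.
Proof.
  intros Hp [d0 Hd0] Hl. apply is_derive_Reals. intros eps Heps.
  destruct (proj1 (is_pd_eps _ _ _ _ _) Hl (mkposreal _ Heps)) as [d Hd].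
  assert (Hm : 0 < Rmin d0 d) by (apply Rmin_pos; apply cond_pos).
  exists (mkposreal _ Hm). intros e He0 He. simpl in He.
  assert (Hm1 := Rmin_l d0 d). assert (Hm2 := Rmin_r d0 d).
  assert (E : get c p + e - get c p = e) by ring.
  specialize (Hd (get c p + e)). rewrite E in Hd. rewrite upd_get.
  apply Hd; [lra|lra|]. apply Hd0.
  change (Rabs (get c p + e - get c p) < d0). rewrite E. lra.
Qed.

Lemma channel_lateral h c p y : c <> space e3 -> channel h p -> channel h (upd c p y).
Proof.
  intros Hc Hp. destruct p as [[[x1 x2] x3] t]. unfold channel in *.
  now destruct c as [[]|].
Qed.

Lemma is_pd_lateral_derive h c f p l : c <> space e3 -> channel h p ->
  is_pd (channel h) c f p l -> is_derive (fun y => f (upd c p y)) (get c p) l.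
Proof.
  intros Hc Hp. apply is_pd_derive; auto. apply filter_forall.
  intros y. now apply channel_lateral.
Qed.

Lemma derive_zero_eq (f : R -> R) : (forall x, is_derive f x 0) -> forall a b, f a = f b.
Proof.
  intros Hf.
  assert (H : forall a b, a <= b -> f b = f a).
  { intros a b Hab. apply is_derive_zero_const; auto.
    intros x _. apply cont_of_derivable. exists 0. apply Hf. }
  intros a b. destruct (Rle_dec a b); [symmetry|]; apply H; lra.
Qed.

Lemma pd_zero_lateral_eq h c f p : c <> space e3 -> 0 < h -> channel h p ->
  (forall q, channel h q -> is_pd (channel h) c f q 0) ->
  forall a b, f (upd c p a) = f (upd c p b).
Proof.
  intros Hc Hh Hp Hf. apply (derive_zero_eq (fun y => f (upd c p y))).
  intros x. assert (Hq := channel_lateral h c p x Hc Hp).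
  assert (H := is_pd_lateral_derive h c f _ 0 Hc Hq (Hf _ Hq)).
  rewrite get_upd in H. eapply is_derive_ext; [|exact H].
  intros y. f_equal. destruct p as [[[x1 x2] x3] t]. now destruct c as [[]|].
Qed.

(* One-sided derivatives at the walls are enough for the mean value theorem. *)
Lemma pd_zero_normal_eq h f x1 x2 t : 0 < h ->
  (forall q, channel h q -> is_pd (channel h) e3 f q 0) ->
  forall z, 0 <= z <= h -> f (x1, x2, z, t) = f (x1, x2, 0, t).
Proof.
  intros Hh Hf z Hz.
  set (g := fun y => f (x1, x2, clamp 0 h y, t)).
  assert (Hpd : forall y, 0 <= y <= h -> forall eps : posreal, exists d : posreal,
    forall y', Rabs (y' - y) < d -> y' <> y -> 0 <= y' <= h ->
    Rabs ((f (x1, x2, y', t) - f (x1, x2, y, t)) / (y' - y) - 0) < eps).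
  { intros y Hy. exact (proj1 (is_pd_eps _ _ _ _ _) (Hf (x1, x2, y, t) Hy)). }
  replace (f (x1, x2, z, t)) with (g z) by (unfold g; now rewrite clamp_id).
  replace (f (x1, x2, 0, t)) with (g 0) by (unfold g; now rewrite clamp_id by lra).
  apply is_derive_zero_const; [easy| |].
  - intros y Hy. apply filterlim_locally. intros eps.
    (* A difference quotient within 1 of the zero derivative is a local Lipschitz bound at y, which
       yields continuity up to the walls. *)
    destruct (Hpd y ltac:(lra) (mkposreal 1 Rlt_0_1)) as [d Hd].
    assert (Hm : 0 < Rmin d eps) by (apply Rmin_pos; apply cond_pos).
    exists (mkposreal _ Hm). intros y' Hy'.
    change (Rabs (y' - y) < Rmin d eps) in Hy'.
    assert (Hm1 := Rmin_l d eps). assert (Hm2 := Rmin_r d eps).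
    change (Rabs (f (x1, x2, clamp 0 h y', t) - f (x1, x2, clamp 0 h y, t)) < eps).
    assert (Hl := clamp_lipschitz 0 h y y').
    assert (Hin := clamp_in 0 h y' ltac:(lra)).
    rewrite (clamp_id 0 h y) in * by lra.
    destruct (Req_dec (clamp 0 h y') y) as [->|Hne].
    + rewrite Rminus_diag, Rabs_R0. apply cond_pos.
    + specialize (Hd (clamp 0 h y') ltac:(lra) Hne Hin). simpl in Hd.
      rewrite Rminus_0_r in Hd. unfold Rdiv in Hd. rewrite Rabs_mult, Rabs_inv in Hd.
      assert (Hp : 0 < Rabs (clamp 0 h y' - y)) by (apply Rabs_pos_lt; lra).
      apply (Rmult_lt_compat_r _ _ _ Hp) in Hd.
      rewrite Rmult_assoc, Rinv_l in Hd by lra. lra.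
  - intros y Hy. apply is_derive_Reals. intros eps Heps.
    destruct (Hpd y ltac:(lra) (mkposreal _ Heps)) as [d Hd].
    assert (Hm : 0 < Rmin d (Rmin y (h - y)))
      by (repeat apply Rmin_pos; try lra; apply cond_pos).
    exists (mkposreal _ Hm). intros e He0 He. simpl in He.
    assert (Hm1 := Rmin_l d (Rmin y (h - y))). assert (Hm2 := Rmin_r d (Rmin y (h - y))).
    assert (Hm3 := Rmin_l y (h - y)). assert (Hm4 := Rmin_r y (h - y)).
    assert (Habs := Rabs_def2 _ _ (Rlt_le_trans _ _ _ He (Rle_trans _ _ _ Hm2 Hm3))).
    assert (Habs' := Rabs_def2 _ _ (Rlt_le_trans _ _ _ He (Rle_trans _ _ _ Hm2 Hm4))).
    unfold g. rewrite !clamp_id by lra.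
    specialize (Hd (y + e)). replace (y + e - y) with e in Hd by ring.
    apply Hd; lra.
Qed.

(** The difference quotients in direction c at p and at its translate to x1 = 0 are equal, so
    independence of x1 passes to derivatives without exchanging partial derivatives. *)
Lemma pd_streamwise_independent h c f p : 0 < h -> c <> space e1 -> channel h p ->
  (forall q, channel h q -> f q = f (upd e1 q 0)) ->
  (forall q, channel h q -> ex_pd (channel h) c f q) ->
  pd (channel h) c f p = pd (channel h) c f (upd e1 p 0).
Proof.
  intros Hh Hc Hp Hf Hex.
  assert (Hp' : channel h (upd e1 p 0)) by now apply channel_lateral.
  apply pd_unique; auto.
  assert (H := pd_correct h c f _ Hh Hp' (Hex _ Hp')).
  revert H. rewrite !is_pd_eps. intros H eps. destruct (H eps) as [d Hd].
  exists d. intros y. specialize (Hd y).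
  assert (Eg : get c (upd e1 p 0) = get c p)
    by (destruct p as [[[x1 x2] x3] t]; now destruct c as [[]|]).
  assert (Eu : upd c (upd e1 p 0) y = upd e1 (upd c p y) 0)
    by (destruct p as [[[x1 x2] x3] t]; now destruct c as [[]|]).
  rewrite Eg, Eu in Hd. intros H1 H2 H3.
  rewrite (Hf _ H3), (Hf _ Hp). apply Hd; auto. now apply channel_lateral.
Qed.

(** Total in all its arguments: beyond a wall the wall value is repeated, which keeps the profile of
    a field continuous on the channel jointly continuous everywhere. *)
Definition transverse_profile (h : R) (f : point -> R) (x t z : R) : R :=
  f (0, x, clamp 0 h z, t).

Lemma transverse_profile_id h f x t z : 0 <= z <= h ->
  transverse_profile h f x t z = f (0, x, z, t).
Proof. intros Hz. unfold transverse_profile. now rewrite clamp_id. Qed.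

Lemma cont3_transverse_profile h f : 0 < h -> Defs.continuous_on (channel h) f ->
  cont3 (transverse_profile h f).
Proof.
  intros Hh Hf [[x t] z].
  assert (Hin : forall y, 0 <= clamp 0 h y <= h) by (intros; apply clamp_in; lra).
  set (phi := fun q : R * R * R => (0, fst (fst q), clamp 0 h (snd q), snd (fst q))).
  assert (Hcl : forall s, continuous (clamp 0 h) s) by apply cont_clamp.
  assert (Hphi : continuous phi (x, t, z)).
  { unfold phi. repeat apply continuous_pair; cont. }
  (* Continuity on the channel is a limit restricted to it; [phi] takes all its values in the
     channel, so the restriction disappears after composition. *)
  intros P HP. assert (H := Hf (phi (x, t, z)) (Hin z) P HP).
  change (locally (x, t, z) (fun q => P (f (phi q)))).
  apply (filter_imp (fun q => channel h (phi q) -> P (f (phi q)))); [|exact (Hphi _ H)].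
  intros q Hq. apply Hq. apply Hin.
Qed.

Lemma derive_transverse_profile_z h f x t z : 0 < z < h ->
  (forall q, channel h q -> ex_pd (channel h) e3 f q) ->
  is_derive (transverse_profile h f x t) z
    (transverse_profile h (pd (channel h) e3 f) x t z).
Proof.
  intros Hz Hex.
  assert (Hd : 0 < Rmin z (h - z)) by (apply Rmin_pos; lra).
  assert (Hm1 := Rmin_l z (h - z)). assert (Hm2 := Rmin_r z (h - z)).
  assert (Hnear : forall y, ball z (mkposreal _ Hd) y -> 0 <= y <= h).
  { intros y Hy. change (Rabs (y - z) < Rmin z (h - z)) in Hy.
    apply Rabs_def2 in Hy. lra. }
  apply (is_derive_ext_loc (fun y => f (0, x, y, t))).
  - exists (mkposreal _ Hd). intros y Hy. now rewrite transverse_profile_id by now apply Hnear.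
  - rewrite transverse_profile_id by lra.
    assert (Hp : channel h (0, x, z, t)) by (unfold channel; simpl; lra).
    apply (is_pd_derive h e3 f (0, x, z, t)); auto.
    + exists (mkposreal _ Hd). intros y Hy. now apply Hnear.
    + apply pd_correct; auto; lra.
Qed.

Lemma derive_transverse_profile_lateral h f (c : coord) x t z : 0 < h ->
  c <> space e3 -> (forall q, channel h q -> ex_pd (channel h) c f q) ->
  is_derive (fun y => f (upd c (0, x, clamp 0 h z, t) y)) (get c (0, x, clamp 0 h z, t))
    (transverse_profile h (pd (channel h) c f) x t z).
Proof.
  intros Hh Hc Hex.
  assert (Hp : channel h (0, x, clamp 0 h z, t)) by (apply clamp_in; lra).
  apply (is_pd_lateral_derive h); auto. apply pd_correct; auto.
Qed.

Lemma class_C_pd D n f c : of_class_C D (S n) f ->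
  (forall p, D p -> ex_pd D c f p) /\ of_class_C D n (pd D c f).
Proof. intros [_ H]. apply H. Qed.

Lemma class_C_continuous D n f : of_class_C D n f -> Defs.continuous_on D f.
Proof. destruct n; now intros [H _]. Qed.

Theorem theorem3p1 (nu h L1 L2 : R) (U P : point -> R)
    (nu_pos : 0 < nu) (h_pos : 0 < h) (L1_pos : 0 < L1) (L2_pos : 0 < L2)
    (solution : navier_stokes (channel h) nu (unidirectional U) P)
    (noslip : no_slip h (unidirectional U))
    (smooth : forall i, smooth_on (channel h) (unidirectional U i))
    (periodic1 : periodic_in (channel h) e1 L1 (unidirectional U))
    (periodic2 : periodic_in (channel h) e2 L2 (unidirectional U))
    (bounded_energy :
       bound (fun E => exists t, E = energy L1 L2 h (unidirectional U) t)) :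
  exists p1 : R -> R,
    (forall p, channel h p -> is_pd (channel h) e1 P p (p1 (get time p))) /\
    exists V : R -> R -> R,
      (forall p, channel h p -> U p = V (get e3 p) (get time p)) /\
      forall x3 t, 0 <= x3 <= h ->
        (forall tau, tau < t ->
           ex_series (fun n => kernel_term nu h x3 (t - tau) (S n))) /\
        is_RInt_gen (fun tau => kernel nu h x3 (t - tau) * p1 tau)
          (Rbar_locally m_infty) (at_point t) (V x3 t).
Proof.
  set (D := channel h) in *.
  assert (smoothU := smooth e1 2%nat : of_class_C D 2 U). clear smooth periodic1.
  assert (CU := class_C_continuous _ _ _ smoothU).
  assert (Hex : forall c p, D p -> ex_pd D c U p)
    by (intros c; apply (class_C_pd _ _ _ c smoothU)).
  assert (C1 : forall c, Defs.continuous_on D (pd D c U))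
    by (intros c; apply (class_C_continuous _ _ _ (proj2 (class_C_pd _ _ _ c smoothU)))).
  assert (Hex2 : forall c c' p, D p -> ex_pd D c' (pd D c U) p).
  { intros c c'. apply (class_C_pd _ _ _ c' (proj2 (class_C_pd _ _ _ c smoothU))). }
  assert (C2 : forall c c', Defs.continuous_on D (pd D c' (pd D c U))).
  { intros c c'. eapply class_C_continuous.
    apply (class_C_pd _ _ _ c' (proj2 (class_C_pd _ _ _ c smoothU))). }
  assert (pd0 : forall c f p, D p -> (forall q, D q -> f q = 0) -> pd D c f p = 0)
    by (intros; now apply pd_zero).
  assert (HU1 : forall p, D p -> pd D e1 U p = 0).
  { intros p Hp. destruct (solution p Hp) as [_ Hdiv].
    unfold sum_axis, unidirectional in Hdiv.
    rewrite (pd0 e2 (fun _ => 0)), (pd0 e3 (fun _ => 0)) in Hdiv by auto. lra. }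
  assert (Ux1 : forall p, D p -> U p = U (upd e1 p 0)).
  { intros p Hp. rewrite <- (upd_get e1 p) at 1.
    apply (pd_zero_lateral_eq h); auto; [easy|].
    intros q Hq. rewrite <- (HU1 q Hq). now apply pd_correct, Hex. }
  assert (Ux1' : forall c, c <> space e1 -> forall p, D p ->
    pd D c U p = pd D c U (upd e1 p 0)).
  { intros c Hc p Hp. apply pd_streamwise_independent; auto. }
  assert (Ux1'' : forall c, c <> space e1 -> forall p, D p ->
    pd D c (pd D c U) p = pd D c (pd D c U) (upd e1 p 0)).
  { intros c Hc p Hp. apply pd_streamwise_independent; auto. }
  (* The convective term is U times the x1-derivative of U, hence zero: the streamwise equation is
     linear. *)
  assert (HP1 : forall p, D p -> pd D e1 P p
    = nu * (pd D e2 (pd D e2 U) p + pd D e3 (pd D e3 U) p) - pd D time U p).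
  { intros p Hp. destruct (solution p Hp) as [Hmom _]. destruct (Hmom e1) as [_ Heq].
    unfold sum_axis, unidirectional in Heq.
    rewrite HU1, (pd0 e1 (pd D e1 U)) in Heq by auto. lra. }
  assert (HPi : forall i : axis, i <> e1 -> forall p, D p -> is_pd D i P p 0).
  { intros i Hi p Hp. destruct (solution p Hp) as [Hmom _].
    destruct (Hmom i) as [Hexi Heq].
    assert (Hi0 : unidirectional U i = fun _ => 0) by now destruct i.
    rewrite Hi0 in Heq. unfold sum_axis in Heq.
    assert (Hz : forall c q, D q -> pd D c (fun _ => 0) q = 0) by (intros; now apply pd0).
    rewrite !Hz, !(pd0 _ (pd D _ _)) in Heq by auto.
    replace 0 with (pd D i P p) by lra. now apply pd_correct. }
  (* Move first down to the bottom wall along x3, then along x2. *)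
  assert (HP : forall x1 x2 x3 t, 0 <= x3 <= h -> P (x1, x2, x3, t) = P (x1, 0, 0, t)).
  { intros x1 x2 x3 t Hx3.
    rewrite (pd_zero_normal_eq h P x1 x2 t h_pos (HPi e3 ltac:(easy)) x3 Hx3).
    apply (pd_zero_lateral_eq h e2 P (x1, 0, 0, t)); auto; try easy.
    - unfold channel; simpl; lra.
    - now apply HPi. }
  set (p1 := fun t => pd D e1 P (0, 0, 0, t)).
  assert (Dline : forall x t, D (x, 0, 0, t)) by (intros; unfold D, channel; simpl; lra).
  assert (HexP : forall p, D p -> ex_pd D e1 P p).
  { intros p Hp. destruct (solution p Hp) as [Hmom _]. apply (Hmom e1). }
  assert (Hp1line : forall x t, pd D e1 P (x, 0, 0, t) = p1 t).
  (* The momentum equation expresses the pressure gradient through U, which does not depend on x1;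
     so P is affine in x1. *)
  { intros x t. unfold p1. rewrite !HP1 by auto.
    rewrite (Ux1' time ltac:(easy) (x, 0, 0, t)), (Ux1'' e2 ltac:(easy) (x, 0, 0, t)),
      (Ux1'' e3 ltac:(easy) (x, 0, 0, t)) by auto.
    reflexivity. }
  assert (Hp1 : forall p, D p -> is_pd D e1 P p (p1 (get time p))).
  { intros [[[x1 x2] x3] t] Hp. change (get time (x1, x2, x3, t)) with t.
    rewrite <- (Hp1line x1).
    assert (H := pd_correct h e1 P _ h_pos (Dline x1 t) (HexP _ (Dline x1 t))).
    revert H. fold D. rewrite !is_pd_eps. intros H eps. destruct (H eps) as [d Hd].
    exists d. intros y Hy Hne HD. specialize (Hd y Hy Hne (Dline y t)).
    simpl in Hd |- *. rewrite (HP y x2 x3 t), (HP x1 x2 x3 t) by exact Hp. exact Hd. }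
  set (u := transverse_profile h U).
  assert (flow : shear_flow nu h L2 p1 u
    (transverse_profile h (pd D time U))
    (transverse_profile h (pd D e2 U)) (transverse_profile h (pd D e2 (pd D e2 U)))
    (transverse_profile h (pd D e3 U)) (transverse_profile h (pd D e3 (pd D e3 U)))).
  { assert (Hcl : forall z, 0 <= clamp 0 h z <= h) by (intros; apply clamp_in; lra).
    assert (Hmom : forall x t z, 0 <= z <= h ->
      transverse_profile h (pd D time U) x t z
      = nu * (transverse_profile h (pd D e2 (pd D e2 U)) x t z
              + transverse_profile h (pd D e3 (pd D e3 U)) x t z) - p1 t).
    { intros x t z Hz. rewrite !transverse_profile_id by easy.
      assert (Hp : D (0, x, z, t)) by exact Hz.
      assert (E := HP1 _ Hp).
      assert (E1 : pd D e1 P (0, x, z, t) = p1 t) by exact (pd_unique h _ _ _ _ h_pos Hp (Hp1 _ Hp)).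
      lra. }
    constructor; try (apply cont3_transverse_profile; auto).
    (* Regularity of P in time is not given; continuity of [p1] is read off the momentum equation at
       the wall point x2 = x3 = 0. *)
    - intros t.
      assert (Ct := cont3_transverse_profile h _ h_pos (C1 time)).
      assert (Cxx := cont3_transverse_profile h _ h_pos (C2 e2 e2)).
      assert (Czz := cont3_transverse_profile h _ h_pos (C2 e3 e3)).
      set (ft := transverse_profile h (pd D time U)) in *.
      set (fxx := transverse_profile h (pd D e2 (pd D e2 U))) in *.
      set (fzz := transverse_profile h (pd D e3 (pd D e3 U))) in *.
      apply (continuous_ext (fun t => nu * (fxx 0 t 0 + fzz 0 t 0) - ft 0 t 0)).
      + intros s. rewrite (Hmom 0 s 0) by lra. at_R; ring.
      + cont.
    - intros x t z. apply (derive_transverse_profile_lateral h U time x t z); auto; easy.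
    - intros x t z. apply (derive_transverse_profile_lateral h U e2 x t z); auto; easy.
    - intros x t z.
      apply (derive_transverse_profile_lateral h (pd D e2 U) e2 x t z); auto; easy.
    - intros x t z Hz. apply derive_transverse_profile_z; auto.
    - intros x t z Hz. apply derive_transverse_profile_z; auto.
    - exact Hmom.
    - intros x t. unfold u. rewrite transverse_profile_id by lra.
      apply (noslip (0, x, 0, t) (or_introl eq_refl) e1).
    - intros x t. unfold u. rewrite transverse_profile_id by lra.
      apply (noslip (0, x, h, t) (or_intror eq_refl) e1).
    - intros x t z Hz. unfold u. rewrite !transverse_profile_id by easy.
      apply (periodic2 (0, x, z, t) Hz e1).
    (* The integral over x1 only contributes a factor L1, since U does not depend on x1. *)
    - destruct bounded_energy as [M HM]. exists (M / L1). intros t.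
      assert (E : energy L1 L2 h (unidirectional U) t
        = L1 * RInt (fun x => RInt (fun z => u x t z * u x t z) 0 h) 0 L2).
      { unfold energy.
        rewrite (RInt_ext _ (fun _ =>
          RInt (fun x => RInt (fun z => u x t z * u x t z) 0 h) 0 L2)).
        - rewrite RInt_cst. at_R; ring.
        - intros x1 _. apply RInt_ext. intros x2 _. apply RInt_ext. intros x3 Hx3.
          rewrite Rmin_left, Rmax_right in Hx3 by lra.
          unfold sum_axis, unidirectional, u. rewrite transverse_profile_id by lra.
          assert (Hp : D (x1, x2, x3, t)) by (unfold D, channel; simpl; lra).
          rewrite (Ux1 _ Hp). simpl. at_R; ring. }
      apply (Rmult_le_reg_l L1); [easy|]. rewrite <- E.
      replace (L1 * (M / L1)) with M by (field; lra). apply HM. now exists t. }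
  exists p1. split; [exact Hp1|].
  exists (fun z t => U (0, 0, z, t)). split.
  - intros [[[x1 x2] x3] t] Hp. simpl get. rewrite (Ux1 _ Hp). simpl upd.
    assert (Hx3 : 0 <= x3 <= h) by exact Hp.
    assert (E := shear_flow_independent nu_pos h_pos L2_pos flow x2 t x3 Hx3).
    unfold u in E. now rewrite !transverse_profile_id in E.
  - intros x3 t Hx3. split.
    + intros tau Htau.
      destruct (kernel_series_uniform nu h x3 nu_pos h_pos Hx3) as [C HC].
      apply HC. lra.
    + assert (H := shear_flow_duhamel nu_pos h_pos L2_pos flow x3 t Hx3).
      unfold u in H. now rewrite transverse_profile_id in H.
Qed.
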